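(* Let $N\ge1$, $\underline d\in\mathbb N^{N+1}$ and $0\le r\le\min\underline d$. Then, as formal power series in $q$, $$Q^r_{\underline d}=\mathcal P_r\cdot\sum_{s=0}^{\min\underline d-r}(-1)^s q^{\binom s2}\,\mathcal P_s\,\mathcal P_{\underline d-r-s},$$ where $\underline d-r-s=(d_0-r-s,\dots,d_N-r-s)$.
   Context: $\mathrm{Rep}_{\underline d}=\prod_{i=1}^N\mathrm{Mat}_{d_i,d_{i-1}}(\mathbb C)$ is the space of tuples $A_*=(A_1,\dots,A_N)$, $A_i$ of size $d_i\times d_{i-1}$. A Kostant partition of $\underline d$ is an array $\underline m=(m_{ij})_{0\le i\le j\le N}$ of nonnegative integers with $d_k=\sum_{i\le k\le j}m_{ij}$ for every $k$; their (finite) set is $\mathcal M^+_{\underline d}$. For $\underline m\in\mathcal M^+_{\underline d}$ put $r_{ij}(\underline m)=\sum_{k\le i,\ j\le l}m_{kl}$ and $\mathcal O_{\underline m}=\{A_*\in\mathrm{Rep}_{\underline d}:\operatorname{rank}(A_jA_{j-1}\cdots A_{i+1})=r_{ij}(\underline m)\ \text{for all }0\le i<j\le N\}$; these are exactly the orbits of $G=\prod_{i=0}^N GL_{d_i}(\mathbb C)$ acting by $(P_i)\cdot A_*=(P_1A_1P_0^{-1},\dots,P_NA_NP_{N-1}^{-1})$. For $s\in\mathbb N$, $\mathcal P_s=\prod_{t=1}^s(1-q^t)^{-1}$ (a formal power series, $\mathcal P_0=1$), and for a finite family $\underline h=(h_i)$ of nonnegative integers $\mathcal P_{\underline h}=\prod_i\mathcal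 P_{h_i}$ (for $\underline m$, the product over all entries $m_{ij}$). Define $Q^r_{\underline d}=\sum_{\underline m\in\mathcal M^+_{\underline d},\ m_{0N}=r}q^{\operatorname{codim}_{\mathrm{Rep}_{\underline d}}\mathcal O_{\underline m}}\mathcal P_{\underline m}$, with complex codimension. *)

(* Defs.v *)
From HB Require Import structures.
From Stdlib Require Import ClassicalEpsilon.
From Stdlib Require Rdefinitions.
From mathcomp Require Import all_boot all_order all_algebra.
From mathcomp Require Import complex.
From mathcomp Require Import Rstruct.
From mathcomp Require Import mpoly.

Set Implicit Arguments.
Unset Strict Implicit.
Unset Printing Implicit Defensive.

Import Order.TTheory GRing.Theory Num.Theory.
Local Open Scope ring_scope.

Definition CC : fieldType := (complex Rdefinitions.R).

Definition pbool (P : Prop) : bool :=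
  if excluded_middle_informative P then true else false.

Definition series := nat -> int.

Definition ps_zero : series := fun _ => 0.
Definition ps_one : series := fun n => (n == 0%N)%:R.
Definition ps_X (k : nat) : series := fun n => (n == k)%:R.
Definition ps_add (f g : series) : series := fun n => f n + g n.
Definition ps_sub (f g : series) : series := fun n => f n - g n.
Definition ps_scale (c : int) (f : series) : series := fun n => c * f n.
Definition ps_mul (f g : series) : series :=
  fun n => \sum_(i < n.+1) f i * g (n - i)%N.

(* Multiplicative inverse of a series with constant term 1:
   g 0 = 1,  g n = - \sum_(1 <= j <= n) f j * g (n - j).
   inv_rev f n = [:: g n; g (n-1); ...; g 0]. *)
Fixpoint inv_rev (f : series) (n : nat) : seq int :=
  match n with
  | 0 => [:: 1]
  | n'.+1 => let s := inv_rev f n' in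
             (- \sum_(i < n'.+1) f i.+1 * nth 0 s i) :: s
  end.
Definition ps_inv (f : series) : series := fun n => head 0 (inv_rev f n).

Definition Pser (s : nat) : series :=
  \big[ps_mul/ps_one]_(1 <= t < s.+1) ps_inv (ps_sub ps_one (ps_X t)).

Section Quiver.
Variables (N : nat) (d : 'I_N.+1 -> nat).

Definition dn (k : nat) : nat := if (k <= N)%N then d (inord k) else 0%N.

(* Coordinates of Rep_d: entry (a,b) of the matrix A_{k+1}, k < N,
   which has size d_{k+1} x d_k. *)
Definition Var : finType := {k : 'I_N & ('I_(dn k.+1) * 'I_(dn k))%type}.

(* A point of Rep_d is a tuple of matrices, i.e. a family of coordinates. *)
Definition Rep := {ffun Var -> CC}.

(* the matrix A_{j+1} : d_{j+1} x d_j of a point x (0 if j >= N) *)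
Definition Amat (x : Rep) (j : nat) : 'M[CC]_(dn j.+1, dn j) :=
  (if (j < N)%N as b return (j < N)%N = b -> 'M[CC]_(dn j.+1, dn j)
   then fun h => \matrix_(a, c)
        x (existT (fun k : 'I_N => ('I_(dn k.+1) * 'I_(dn k))%type)
                  (Ordinal h) (a, c))
   else fun _ => 0) erefl.

(* pathmx x i j = A_j A_{j-1} ... A_{i+1}  (identity if i = j), for i <= j *)
Fixpoint pathmx (x : Rep) (i j : nat) : 'M[CC]_(dn j, dn i) :=
  match j with
  | 0 => conform_mx 0 (1%:M : 'M[CC]_(dn i))
  | j'.+1 => if (i <= j')%N then Amat x j' *m pathmx x i j'
             else conform_mx 0 (1%:M : 'M[CC]_(dn i))
  end.

(* Kostant partitions; entries m_{ij} (i <= j) are bounded by the sum of the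
   d_k, so they can be encoded as a finite function. *)
Definition bnd : nat := (\sum_(k < N.+1) d k).+1.
Definition KP := {ffun 'I_N.+1 * 'I_N.+1 -> 'I_bnd}.

Definition mE (m : KP) (i j : 'I_N.+1) : nat := m (i, j).

Definition kostant (m : KP) : bool :=
  [forall i : 'I_N.+1, forall j : 'I_N.+1, (j < i)%N ==> (mE m i j == 0%N)] &&
  [forall k : 'I_N.+1,
     d k == \sum_(i < N.+1) \sum_(j < N.+1 | (i <= k <= j)%N) mE m i j].

Definition rk (m : KP) (i j : 'I_N.+1) : nat :=
  \sum_(k < N.+1 | (k <= i)%N) \sum_(l < N.+1 | (j <= l)%N) mE m k l.

Definition orbit (m : KP) : pred Rep := fun x =>
  [forall i : 'I_N.+1, forall j : 'I_N.+1,
     (i < j)%N ==> (\rank (pathmx x i j) == rk m i j)].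

Definition nv : nat := #|{: Var}|.
Definition coords (x : Rep) : 'I_nv -> CC := fun i => x (enum_val i).

Definition in_vars (J : {set 'I_nv}) (p : {mpoly CC[nv]}) : Prop :=
  forall mo, mo \in msupp p -> forall i, i \notin J -> mo i = 0%N.

Definition alg_indep (S : pred Rep) (J : {set 'I_nv}) : Prop :=
  forall p : {mpoly CC[nv]}, in_vars J p ->
    (forall x, S x -> p.@[coords x] = 0) -> p = 0.

(* (Krull) dimension of the Zariski closure of S = maximal number of
   coordinate functions algebraically independent on S *)
Definition dimS (S : pred Rep) : nat :=
  \max_(J : {set 'I_nv} | pbool (alg_indep S J)) #|J|.

Definition codim (S : pred Rep) : nat := (nv - dimS S)%N.

Definition Pm (m : KP) : series :=
  \big[ps_mul/ps_one]_(i < N.+1) \big[ps_mul/ps_one]_(j < N.+1 | (i <= j)%N)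
     Pser (mE m i j).

Definition Qser (r : nat) : series :=
  \big[ps_add/ps_zero]_(m : KP | kostant m && (mE m ord0 ord_max == r))
     ps_mul (ps_X (codim (orbit m))) (Pm m).

Definition Pvec (h : 'I_N.+1 -> nat) : series :=
  \big[ps_mul/ps_one]_(k < N.+1) Pser (h k).

Definition mind : nat := \big[minn/d ord0]_(k < N.+1) d k.

End Quiver.

(* Main.v *)
(* Both sides are computed from a formula for the codimension. Label a basis of C^(d_k) by
   the strings (copies of intervals [i, j]) passing through k. The orbit of m has codimension
   #{(k, s, t) : s ends at k, t passes through k + 1, t starts after s}, because the coordinates
   outside this set are algebraically independent on the orbit (at the normal form, the tangent
   directions of the group action surject onto them), while the orbit is covered by finitely many
   rational images of an affine space with as many parameters (any point has a basis, adapted to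
   the flags of images, starting from standard basis vectors).

   Grouping the strings by their starting point, the codimension is the sum over i <= k < N of
   m_ik (d_(k+1) - r_(i,k+1)). Hence the sum over m can be done one row at a time, and each row one
   entry at a time, by the Durfee-rectangle identity
     sum_b P_(a-b) P_b P_(e-b) q^((a-b)(e-b)) = P_a P_e.
   The rows i >= 1 contribute a product of P's; the row 0, with m_0N = r, gives the alternating
   sum, starting from sum_s (-1)^s q^C(s,2) P_s P_(n-s) = [n = 0]. *)
From HB Require Import structures.
Require Import Defs.
From mathcomp Require Import all_boot all_order all_algebra.
From mathcomp Require Import mpoly.
From mathcomp Require boolp complex Rstruct.
From mathcomp Require Import zify ring.

Set Implicit Arguments.
Unset Strict Implicit.
Unset Printing Implicit Defensive.

Import Order.TTheory GRing.Theory Num.Theory.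
Local Open Scope ring_scope.

(** * Polynomial functions *)

(** Dimension is defined through algebraic independence of coordinates, so both bounds concern
    polynomials vanishing on an orbit. The lower bound moves the normal form along curves that must
    be polynomial, while the inverse of a polynomial matrix is not; adjugates replace inverses, at
    the cost of scalar factors that ranks do not see. In the upper bound, counting monomials
    replaces the theory of transcendence degrees. Each coordinate in column s of A_(k+1) stands for
    one parameter: an entry of the basis vector of s at k + 1 if s goes on, and if s ends at k, a
    coefficient of its image in the basis at k + 1. The image of s lies in the span of the strings
    starting no later than s, so the parameters at the excluded coordinates are 0 and the two bounds
    meet. Relations found for the different choices of standard basis vectors are multiplied
    together. *)

Section PolynomialFunctions.
Variables (F : fieldType).
Hypothesis charF : [pchar F] =i pred0.

Lemma poly_eq0_horner (p : {poly F}) : (forall x, p.[x] = 0) -> p = 0.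
Proof.
move=> h; apply: (@roots_geq_poly_eq0 _ _ [seq i%:R | i <- iota 0 (size p)]).
- by apply/allP => x _; apply/rootP.
- rewrite map_inj_uniq ?iota_uniq // => i j e.
  wlog le : i j e / (i <= j)%N.
    by move=> W; case/orP: (leq_total i j) => h1; [exact: W|symmetry; exact: W].
  move/eqP: e; rewrite eq_sym -subr_eq0 -natrB // (proj1 (pcharf0P F) charF); lia.
- by rewrite size_map size_iota.
Qed.

Lemma digits_inj B n (f g : 'I_n -> nat) : (forall i, (f i < B)%N) -> (forall i, (g i < B)%N) ->
  (\sum_(i < n) f i * B ^ i = \sum_(i < n) g i * B ^ i)%N -> f =1 g.
Proof.
elim: n f g => [|n IH] f g fB gB; first by move=> _ [].
have rec (k : 'I_n.+1 -> nat) : (\sum_(i < n.+1) k i * B ^ i =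
    k ord0 + (\sum_(i < n) k (lift ord0 i) * B ^ i) * B)%N.
  rewrite big_ord_recl expn0 muln1 big_distrl /=; congr addn.
  by apply: eq_bigr => i _; rewrite /bump add1n expnSr mulnA.
have B0 : (0 < B)%N := leq_ltn_trans (leq0n _) (fB ord0).
rewrite !rec => e.
have e0 : f ord0 = g ord0.
  by have := congr1 (modn^~ B) e; rewrite ![(_ ord0 + _)%N]addnC !modnMDl !modn_small.
have e1 : (\sum_(i < n) f (lift ord0 i) * B ^ i = \sum_(i < n) g (lift ord0 i) * B ^ i)%N.
  by apply/eqP; rewrite -(eqn_pmul2r B0); apply/eqP; apply: (@addnI (f ord0)); rewrite e e0.
move=> i; case: (unliftP ord0 i) => [j|] -> //.
exact: (IH (fun i => f (lift ord0 i)) (fun i => g (lift ord0 i))).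
Qed.

Lemma mnm_lt_msize n (p : {mpoly F[n]}) m i : m \in msupp p -> (m i < msize p)%N.
Proof.
move=> /msize_mdeg_lt; apply: leq_ltn_trans; rewrite mdegE (bigD1 i) //=; exact: leq_addr.
Qed.

(* Kronecker substitution 'X_i := z ^ (B ^ i), with B above all exponents. *)
Lemma mpoly_eq0_meval n (p : {mpoly F[n]}) : (forall v, p.@[v] = 0) -> p = 0.
Proof.
move=> h; pose B := msize p; pose w (m : 'X_{1..n}) := (\sum_(i < n) m i * B ^ i)%N.
pose Q : {poly F} := \sum_(m <- msupp p) p@_m *: 'X^(w m).
have Q0 : Q = 0.
  apply: poly_eq0_horner => z; rewrite -(h (fun i => z ^+ (B ^ i))) mevalE horner_sum.
  apply: eq_bigr => m _; rewrite hornerZ hornerXn -prodrXr; congr (_ * _).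
  by apply: eq_bigr => i _; rewrite mulnC exprM.
apply/mpolyP => m; rewrite mcoeff0; apply/eqP/contraT; rewrite -mcoeff_msupp => mp.
have := congr1 (fun q : {poly F} => q`_(w m)) Q0.
rewrite coef_sum coef0 (bigD1_seq m) ?msupp_uniq //= coefZ coefXn eqxx mulr1.
rewrite big_seq_cond big1 ?addr0 => [/eqP|m' /andP[m'p ne]]; first by rewrite mcoeff_eq0 mp.
rewrite coefZ coefXn; case: eqP => [e|]; last by rewrite mulr0.
case/eqP: ne; apply/mnmP => i; symmetry.
by apply: (@digits_inj B n (fun i => m i) (fun i => m' i)) => // j; apply: mnm_lt_msize.
Qed.

Lemma mmap_comp n k (S : comNzRingType) (f : {rmorphism F -> S}) (h : 'I_k -> S)
    (lq : n.-tuple {mpoly F[k]}) (p : {mpoly F[n]}) :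
  mmap f h (p \mPo lq) = mmap f (fun i => mmap f h (tnth lq i)) p.
Proof.
rewrite comp_mpolyEX [in RHS](mpolyE p) !raddf_sum /=.
apply/eq_bigr => m _; rewrite !mmapZ; congr *%R.
rewrite comp_mpolyX rmorph_prod /= mmapX.
by apply/eq_bigr=> i _; rewrite rmorphXn.
Qed.

(** After division by ['X^e], with e the lowest degree in q, the value at 0 is the lowest
    homogeneous form of q at v. So this form vanishes everywhere, against the choice of e. *)
Lemma mpoly_eq0_directions n (q : {mpoly F[n]}) :
  (forall v : 'I_n -> F, exists2 u : 'I_n -> {poly F},
     forall i, (u i).[0] = v i & mmap (@polyC F) (fun i => 'X * u i) q = 0) -> q = 0.
Proof.
move=> h; apply/eqP/contraT => q0.
have [m0 m0q m0min] : exists2 m0, m0 \in msupp q & forall m, m \in msupp q -> (mdeg m0 <= mdeg m)%N.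
  have mlq := mlead_supp q0.
  have ex : exists e, has (fun m : 'X_{1..n} => mdeg m == e) (msupp q).
    by exists (mdeg (mlead q)); apply/hasP; exists (mlead q).
  case: (ex_minnP ex) => e /hasP[m0 m0q /eqP <-] emin.
  by exists m0 => // m mq; apply: emin; apply/hasP; exists m.
pose e := mdeg m0.
pose qe := \sum_(m <- msupp q | mdeg m == e) q@_m *: 'X_[m].
have qe0 : qe = 0.
  apply: mpoly_eq0_meval => v; have [u uv qu] := h v.
  have : 'X^e * \sum_(m <- msupp q) (q@_m)%:P * ('X^(mdeg m - e) * \prod_i u i ^+ m i) = 0 :>
    {poly F}.
    rewrite -[RHS]qu mulr_sumr /mmap big_seq [RHS]big_seq; apply: eq_bigr => m mq.
    rewrite mulrCA; congr (_ * _); rewrite mulrA -exprD subnKC ?m0min //.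
    rewrite /mmap1 mdegE -prodrXr -big_split /=.
    by apply: eq_bigr => i _; rewrite exprMn.
  move/eqP; rewrite mulf_eq0 expf_eq0 polyX_eq0 andbF /= => /eqP/(congr1 (horner^~ 0)).
  rewrite horner0 horner_sum => qv; rewrite -[RHS]qv rmorph_sum /= big_mkcond big_seq [RHS]big_seq.
  apply: eq_bigr => m mq; rewrite hornerM hornerC hornerM hornerXn expr0n subn_eq0 horner_prod.
  have -> : (mdeg m <= e)%N = (mdeg m == e) by rewrite eqn_leq m0min // andbT.
  case: ifP => _; last by rewrite mul0r mulr0.
  rewrite mevalZ mevalX mul1r; congr (_ * _).
  by apply: eq_bigr => i _; rewrite horner_exp uv.
have := congr1 (mcoeff m0) qe0; rewrite mcoeff0 raddf_sum /= big_mkcond.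
rewrite (bigD1_seq m0) ?msupp_uniq //= eqxx big1 ?addr0 => [|m ne].
  by move/eqP; rewrite mcoeffZ mcoeffX eqxx mulr1 mcoeff_eq0 m0q.
by case: ifP => // _; rewrite mcoeffZ mcoeffX (negbTE ne) mulr0.
Qed.

(* The lowest form of p at x0 vanishes in every direction. *)
Lemma mpoly_eq0_curves n (p : {mpoly F[n]}) (x0 : 'I_n -> F) :
  (forall v : 'I_n -> F, exists2 u : 'I_n -> {poly F},
     forall i, (u i).[0] = v i & mmap (@polyC F) (fun i => (x0 i)%:P + 'X * u i) p = 0) -> p = 0.
Proof.
move=> h; pose lq := [tuple 'X_i + (x0 i)%:MP | i < n] : n.-tuple {mpoly F[n]}.
have q0 : p \mPo lq = 0.
  apply: mpoly_eq0_directions => v; have [u uv pu] := h v; exists u => //.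
  have E i : mmap (@polyC F) (fun i => 'X * u i) (tnth lq i) = (x0 i)%:P + 'X * u i.
    by rewrite tnth_mktuple mmapD mmapX mmap1U mmapC addrC.
  rewrite mmap_comp -[RHS]pu; apply: eq_bigr => m _; congr (_ * _).
  exact: mmap1_eq.
apply: mpoly_eq0_meval => v.
have := comp_mpoly_meval (fun i => v i - x0 i) p lq; rewrite q0 meval0 => ->.
by apply: meval_eq => i; rewrite tnth_mktuple mevalD mevalXU mevalC subrK.
Qed.

End PolynomialFunctions.

(** * Algebraic dependence on rational images of affine space *)

Section AlgebraicDependence.
Variables (F : fieldType).

Lemma msizeM_leq n (p q : {mpoly F[n]}) a b :
  (msize p <= a.+1)%N -> (msize q <= b.+1)%N -> (msize (p * q) <= (a + b).+1)%N.
Proof.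
have [->|p0] := eqVneq p 0; first by rewrite mul0r msize0.
have [->|q0] := eqVneq q 0; first by rewrite mulr0 msize0.
by move=> pa qb; rewrite msizeM //; move: (msize p) (msize q) pa qb => *; lia.
Qed.

Lemma msizeX_leq n (p : {mpoly F[n]}) a k :
  (msize p <= a.+1)%N -> (msize (p ^+ k) <= (a * k).+1)%N.
Proof.
move=> h; elim: k => [|k IH]; first by rewrite expr0 msize1.
by rewrite exprS mulnS; apply: msizeM_leq.
Qed.

Lemma msize_prod_leq n (I : finType) (A : {set I}) (p : I -> {mpoly F[n]}) a :
  (forall i, i \in A -> msize (p i) <= a.+1)%N -> (msize (\prod_(i in A) p i) <= (#|A| * a).+1)%N.
Proof.
move=> h; rewrite -sum_nat_const.
apply: (big_ind2 (fun (x : {mpoly F[n]}) y => (msize x <= y.+1)%N)) => //.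
- by rewrite msize1.
- by move=> *; apply: msizeM_leq.
Qed.

(* There are K ^ #|J| monomials with exponents < K in the variables J, but their pullbacks
   lie in a space of dimension O(K ^ D). *)
Lemma rational_image_dependent n D (J : {set 'I_n}) (f g : 'I_n -> {mpoly F[D]}) :
  (D < #|J|)%N ->
  exists2 p : {mpoly F[n]}, p != 0 &
    (forall m, m \in msupp p -> forall i, i \notin J -> m i = 0%N) /\
    forall (x : 'I_n -> F) (t : 'I_D -> F),
      (forall i, (g i).@[t] != 0 /\ x i * (g i).@[t] = (f i).@[t]) -> p.@[x] = 0.
Proof.
move=> ltD.
have /card_gt0P[j0 j0J] : (0 < #|J|)%N by exact: leq_ltn_trans ltD.
pose L := (\max_(i < n) maxn (msize (f i)) (msize (g i)))%N.
have Lf i : (msize (f i) <= L.+1)%N.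
  rewrite leqW // (leq_trans (leq_maxl _ (msize (g i)))) //.
  exact: (leq_bigmax (F := fun i => maxn (msize (f i)) (msize (g i)))).
have Lg i : (msize (g i) <= L.+1)%N.
  rewrite leqW // (leq_trans (leq_maxr (msize (f i)) _)) //.
  exact: (leq_bigmax (F := fun i => maxn (msize (f i)) (msize (g i)))).
(* K exceeds (#|J| * L + 1)^D, so that M^D <= ((#|J| * L + 1) * K)^D < K^(D + 1) <= K^#|J|: there
   are more monomials than coefficients to kill. *)
pose K := ((#|J| * L).+1 ^ D).+1.
pose M := (#|J| * (L * K)).+1.
pose E1 : finType := {ffun 'I_#|J| -> 'I_K}.
pose E2 : finType := {ffun 'I_D -> 'I_M}.
pose ex (e : E1) i : nat := e (enum_rank_in j0J i).
pose mon (e : E1) : 'X_{1..n} := [multinom (if i \in J then ex e i else 0)%N | i < n].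
pose mon2 (h : E2) : 'X_{1..D} := [multinom (h i : nat) | i < D].
(* The pullback of the monomial [mon e], multiplied by the denominator common to all of them, the
   product of the [g i ^+ K]. *)
pose G (e : E1) := \prod_(i in J) (f i ^+ ex e i * g i ^+ (K - ex e i)).
have Gsz e : (msize (G e) <= M)%N.
  apply: msize_prod_leq => i _.
  have -> : (L * K = L * ex e i + L * (K - ex e i))%N.
    by rewrite -mulnDr subnKC // ltnW // ltn_ord.
  by apply: msizeM_leq; apply: msizeX_leq.
pose C : 'M[F]_(#|E1|, #|E2|) := \matrix_(a, b) (G (enum_val a))@_(mon2 (enum_val b)).
have ltC : (#|E2| < #|E1|)%N.
  rewrite !card_ffun !card_ord.
  have le1 : (M <= (#|J| * L).+1 * K)%N.
    by rewrite /M mulSn mulnA addnC -addn1 leq_add2l.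
  apply: (@leq_ltn_trans (((#|J| * L).+1 * K) ^ D)%N); first by case: (D) => // D';
    rewrite leq_exp2r.
  rewrite expnMn; apply: (@leq_trans (K * K ^ D)%N).
    by rewrite ltn_pmul2r ?expn_gt0 // /K ltnSn.
  by rewrite -expnS leq_pexp2l.
have ker0 : kermx C != 0.
  by rewrite -mxrank_eq0 mxrank_ker -lt0n subn_gt0 (leq_ltn_trans (rank_leq_col _)).
have [a0 [b0 ab0]] : exists a0, exists b0, kermx C a0 b0 != 0.
  have [a /eqP/rowP ne|h] := pickP (fun a => row a (kermx C) != 0); last first.
    by case/eqP: ker0; apply/row_matrixP => a; move/negbFE/eqP: (h a) => ->; rewrite row0.
  have [b neb|h] := pickP (fun b => kermx C a b != 0); first by exists a, b.
  by case: ne => b; rewrite [LHS]mxE [RHS]mxE; move/negbFE/eqP: (h b).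
pose lam a := kermx C a0 a.
have lamC h : \sum_a lam a * (G (enum_val a))@_(mon2 h) = 0.
  have e : (kermx C *m C) a0 (enum_rank h) = 0 by rewrite mulmx_ker mxE.
  rewrite -[RHS]e mxE; apply: eq_bigr => a _.
  by rewrite [C a _]mxE enum_rankK.
have GC : \sum_a lam a *: G (enum_val a) = 0.
  apply/mpolyP => m; rewrite mcoeff0 raddf_sum /=.
  under eq_bigr => a _ do rewrite mcoeffZ.
  have [/forallP h|] := boolP [forall i, (m i < M)%N].
    have -> : m = mon2 [ffun i => Ordinal (h i)] by apply/mnmP => i; rewrite mnmE ffunE.
    exact: lamC.
  rewrite negb_forall => /existsP[i]; rewrite -leqNgt => le.
  apply: big1 => a _; rewrite (_ : _@_m = 0) ?mulr0 //; apply/eqP.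
  rewrite mcoeff_eq0 msize_mdeg_ge // (leq_trans (Gsz _)) // (leq_trans le) //.
  by rewrite mdegE (bigD1 i) //= leq_addr.
have mon_inj : injective mon.
  move=> e e' /mnmP h; apply/ffunP => a; apply/val_inj.
  have := h (enum_val a); rewrite !mnmE enum_valP /ex.
  by rewrite enum_valK_in.
exists (\sum_a lam a *: 'X_[mon (enum_val a)]).
  apply/eqP => /(congr1 (mcoeff (mon (enum_val b0)))).
  rewrite mcoeff0 raddf_sum /= (bigD1 b0) //= mcoeffZ mcoeffX eqxx mulr1 big1 ?addr0.
    by apply/eqP.
  move=> a ne; rewrite mcoeffZ mcoeffX; case: eqP => [/mon_inj/enum_val_inj e|];
    last by rewrite mulr0.
  by rewrite e eqxx in ne.
split=> [m mp i iJ|x t h].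
  have [a /eqP ->] : exists a : 'I_#|E1|, m == mon (enum_val a).
    apply/existsP; move: mp; apply: contraLR; rewrite negb_exists => /forallP hm.
    rewrite mcoeff_msupp negbK raddf_sum /= big1 // => a _.
    by rewrite mcoeffZ mcoeffX eq_sym (negbTE (hm a)) mulr0.
  by rewrite mnmE (negbTE iJ).
have nz : \prod_(i in J) (g i).@[t] ^+ K != 0.
  by apply/prodf_neq0 => i _; rewrite expf_neq0 //; case: (h i).
apply: (mulIf nz); rewrite mul0r -[RHS](meval0 t) -GC !rmorph_sum /= mulr_suml.
apply: eq_bigr => a _; rewrite !mevalZ mevalX rmorph_prod /= -mulrA; congr (_ * _).
rewrite [\prod_(i < n) _](bigID (mem J)) /= [X in _ * X * _]big1 ?mulr1; last first.
  by move=> i iJ; rewrite mnmE (negbTE iJ).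
rewrite -big_split; apply: eq_bigr => i iJ /=.
rewrite mnmE iJ rmorphM !rmorphXn /=; have [_ <-] := h i.
by rewrite exprMn -mulrA -exprD subnKC // ltnW // ltn_ord.
Qed.
End AlgebraicDependence.

(** * Strings and normal forms *)

Section Characteristic.
Import complex Rstruct.

Lemma pchar_CC : [pchar CC] =i pred0.
Proof. exact: (@pchar_num (complex Rdefinitions.R)). Qed.

End Characteristic.

(* Keeps simplification from unfolding the carrier of CC and losing its canonical structures. *)
Local Opaque CC.

Section Paths.
Variables (N : nat) (d : 'I_N.+1 -> nat).
Local Notation dn := (dn d).

Lemma dn_lt_bnd k : (dn k < bnd d)%N.
Proof.
rewrite /Defs.dn; case: ifP => // h; rewrite /bnd ltnS (bigD1 (inord k)) //=; exact: leq_addr.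
Qed.

Definition var k (hk : (k < N)%N) (a : 'I_(dn k.+1)) (c : 'I_(dn k)) : Var d :=
  existT (fun k : 'I_N => ('I_(dn k.+1) * 'I_(dn k))%type) (Ordinal hk) (a, c).

Lemma varE (v : Var d) : exists k hk a c, v = @var k hk a c.
Proof. by case: v => -[k hk] [a c]; exists k, hk, a, c. Qed.

(** [Amat] over arbitrary coefficients, to be used with unknowns as well as with numbers; repeating
    the dependent [if] makes the two convertible. *)
Definition vmat (R : nmodType) (x : Var d -> R) (j : nat) : 'M[R]_(dn j.+1, dn j) :=
  (if (j < N)%N as b return (j < N)%N = b -> 'M[R]_(dn j.+1, dn j)
   then fun h => \matrix_(a, c) x (var h a c)
   else fun _ => 0) erefl.

Lemma vmatE (R : nmodType) (x : Var d -> R) k (hk : (k < N)%N) a c : vmat x k a c = x (var hk a c).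
Proof.
rewrite /vmat.
have gen b (e : (k < N)%N = b) : (if b as b return (k < N)%N = b -> 'M[R]_(dn k.+1, dn k)
   then fun h => \matrix_(a, c) x (var h a c) else fun _ => 0) e a c = x (var hk a c).
  case: b e => [e|]; first by rewrite mxE (bool_irrelevance e hk).
  by rewrite hk.
exact: gen.
Qed.

Lemma Amat_vmat (x : Rep d) k : Amat x k = vmat x k.
Proof. by []. Qed.

Definition rep_of (A : forall k : nat, 'M[CC]_(dn k.+1, dn k)) : Rep d :=
  [ffun v : Var d => A (tag v) (tagged v).1 (tagged v).2].

Lemma Amat_rep_of A k : (k < N)%N -> Amat (rep_of A) k = A k.
Proof. by move=> hk; apply/matrixP => a c; rewrite Amat_vmat (vmatE _ hk) ffunE. Qed.

Lemma pathmx_id (x : Rep d) i : pathmx x i i = 1%:M.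
Proof. by case: i => [|i] /=; rewrite ?ltnn conform_mx_id. Qed.

Lemma pathmxS (x : Rep d) i j : (i <= j)%N -> pathmx x i j.+1 = Amat x j *m pathmx x i j.
Proof. by move=> /= ->. Qed.

Lemma pathmx_trans (x : Rep d) i j k : (i <= j)%N -> (j <= k)%N ->
  pathmx x i k = pathmx x j k *m pathmx x i j.
Proof.
move=> lij; elim: k => [|k IH]; first by case: j lij => // _ _; rewrite pathmx_id mul1mx.
rewrite leq_eqVlt => /orP[/eqP <-|]; first by rewrite pathmx_id mul1mx.
rewrite ltnS => ljk; rewrite !pathmxS //; last exact: leq_trans ljk.
by rewrite IH // mulmxA.
Qed.

(** Nonzero scalars do not affect ranks; allowing the factors [c] leaves room for adjugates in place
    of inverses. *)
Lemma rank_pathmx_gauge (x y : Rep d) (H : forall k : nat, 'M[CC]_(dn k)) (c : nat -> CC) :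
  (forall k, (k <= N)%N -> H k \in unitmx) -> (forall k, (k < N)%N -> c k != 0) ->
  (forall k, (k < N)%N -> Amat y k *m H k = c k *: (H k.+1 *m Amat x k)) ->
  forall i j, (i <= j)%N -> (j <= N)%N -> \rank (pathmx y i j) = \rank (pathmx x i j).
Proof.
move=> Hu c0 Hc i j lij ljN.
have [C C0 e] : exists2 C : CC, C != 0 & pathmx y i j *m H i = C *: (H j *m pathmx x i j).
  elim: j lij ljN => [|j IH] lij ljN.
    have -> : i = 0%N by lia.
    by exists 1; rewrite ?oner_neq0 // !pathmx_id mulmx1 mul1mx scale1r.
  move: lij; rewrite leq_eqVlt => /orP[/eqP ->|].
    by exists 1; rewrite ?oner_neq0 // !pathmx_id mulmx1 mul1mx scale1r.
  rewrite ltnS => lij; have [C C0 e] := IH lij (ltnW ljN).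
  exists (C * c j); first by rewrite mulf_neq0 ?c0.
  rewrite !pathmxS // -mulmxA e -scalemxAr [Amat y j *m (_ *m _)]mulmxA Hc // -scalemxAl -mulmxA
    scalerA.
  by [].
have Hi : row_free (H i) by rewrite row_free_unit Hu // (leq_trans lij).
rewrite -(mxrankMfree _ Hi) e mxrank_scale_nz //.
rewrite -mxrank_tr trmx_mul mxrankMfree ?mxrank_tr //.
by rewrite row_free_unit unitmx_tr Hu.
Qed.

End Paths.

Section Strings.
Variables (N : nat) (d : 'I_N.+1 -> nat) (m : KP d).
Hypothesis km : kostant m.
Local Notation dn := (dn d).

(* ((i, j), c) with c < m i j is the c-th copy of the interval [i, j]. *)
Local Notation strT := ('I_N.+1 * 'I_N.+1 * 'I_(bnd d))%type.
Definition st (s : strT) : nat := s.1.1.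
Definition en (s : strT) : nat := s.1.2.
Definition contains (k : nat) (s : strT) : bool := (s.2 < m s.1)%N && (st s <= k <= en s)%N.

Lemma card_str (Q : rel 'I_N.+1) :
  #|[pred s : strT | (s.2 < m s.1)%N && Q s.1.1 s.1.2]| =
  (\sum_(i < N.+1) \sum_(j < N.+1 | Q i j) mE m i j)%N.
Proof.
rewrite -sum1_card -(pair_big_dep xpredT (fun p (c : 'I_(bnd d)) => (c < m p)%N && Q p.1 p.2)
  (fun _ _ => 1%N)) /=.
rewrite [RHS]pair_big_dep /= [RHS]big_mkcond /=; apply: eq_bigr => -[i j] _ /=.
case: (Q i j); last by rewrite big_pred0 // => c; rewrite andbF.
rewrite /mE -[RHS]card_ord -[RHS]sum1_card.
rewrite (big_ord_widen _ (fun=> 1%N) (ltnW (ltn_ord (m (i, j))))).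
by apply: eq_bigl => c; rewrite andbT.
Qed.

Lemma card_contains k : (k <= N)%N -> #|contains k| = dn k.
Proof.
move=> kN; rewrite /dn kN.
have /andP[_ /forallP/(_ (inord k))/eqP ->] := km.
by rewrite inordK ?ltnS // -(card_str (fun i j => (i <= k <= j)%N)).
Qed.

Definition str0 : strT := (ord0, ord0, ord0).
Definition lab (k : nat) (a : 'I_(dn k)) : strT := nth str0 (enum (contains k)) a.

Lemma size_contains k : (k <= N)%N -> size (enum (contains k)) = dn k.
Proof. by move=> kN; rewrite -cardE card_contains. Qed.

Lemma has_lab k (a : 'I_(dn k)) : (k <= N)%N -> contains k (lab a).
Proof.
move=> kN; have : lab a \in enum (contains k) by rewrite mem_nth // size_contains.
by rewrite mem_enum.
Qed.

Lemma lab_inj k (a b : 'I_(dn k)) : (k <= N)%N -> (lab a == lab b) = (a == b).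
Proof. by move=> kN; rewrite nth_uniq ?enum_uniq // size_contains. Qed.

(** Sums over matrix indices at different vertices all become sums over the one type of strings. *)
Lemma big_lab (T : Type) (idx : T) (op : Monoid.com_law idx) k (F : strT -> T) : (k <= N)%N ->
  \big[op/idx]_(a < dn k) F (lab a) = \big[op/idx]_(s | contains k s) F s.
Proof.
move=> kN; transitivity (\big[op/idx]_(s <- enum (contains k)) F s); last by rewrite big_enum.
by rewrite (big_nth str0) size_contains // big_mkord.
Qed.

Lemma lab_surj k s : (k <= N)%N -> contains k s -> exists a : 'I_(dn k), lab a = s.
Proof.
move=> kN hs; have si : s \in enum (contains k) by rewrite mem_enum.
have lt : (index s (enum (contains k)) < dn k)%N by rewrite -size_contains // index_mem.
by exists (Ordinal lt); rewrite /lab nth_index.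
Qed.

Lemma contains_mid i j k s : contains i s -> contains k s -> (i <= j <= k)%N -> contains j s.
Proof. by rewrite /contains => /andP[-> /= h1] /= h2 h3; lia. Qed.

(** The direct sum of interval representations: a basis vector goes to that of the same string at
    the next vertex, or to 0 if the string ends. *)
Definition normal_rep : Rep d :=
  rep_of (fun k => \matrix_(a, c) (lab a == lab c)%:R).

Lemma Amat_normal k a c : (k < N)%N -> Amat normal_rep k a c = (lab a == lab c)%:R.
Proof. by move=> hk; rewrite Amat_rep_of // mxE. Qed.

Lemma pathmx_normal i j : (i <= j)%N -> (j <= N)%N ->
  pathmx normal_rep i j = \matrix_(a, c) (lab a == lab c)%:R.
Proof.
elim: j => [|j IH] lij ljN.
  have -> : i = 0%N by lia.
  by rewrite pathmx_id; apply/matrixP => a c; rewrite !mxE lab_inj.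
move: lij; rewrite leq_eqVlt => /orP[/eqP ->|].
  by rewrite pathmx_id; apply/matrixP => a c; rewrite !mxE lab_inj.
rewrite ltnS => lij; rewrite pathmxS // IH //; last exact: ltnW.
apply/matrixP => a c; rewrite !mxE.
under eq_bigr => b _ do rewrite Amat_normal // mxE.
rewrite (big_lab _ (fun s => (lab a == s)%:R * (s == lab c)%:R)) ?(ltnW ljN) //.
have [e|ne] := eqVneq (lab a) (lab c).
  have hj : contains j (lab c).
    apply: (@contains_mid i j j.+1); rewrite ?lij ?leqnSn //.
      by apply: has_lab; rewrite (leq_trans lij) // ltnW.
    by rewrite -e; apply: has_lab.
  rewrite (bigD1 (lab c)) //= e !eqxx mul1r big1 ?addr0 // => s /andP[_ /negbTE ->].
  by rewrite mulr0.
rewrite big1 // => s _; case: eqP => [<-|]; last by rewrite mul0r.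
by rewrite (negbTE ne) mulr0.
Qed.

Lemma card_rk (i j : 'I_N.+1) : (i <= j)%N -> #|[pred s | contains i s && contains j s]| = rk m i j.
Proof.
move=> lij; rewrite /rk [RHS]big_mkcond /=.
transitivity (\sum_(i0 < N.+1) \sum_(j0 < N.+1 | (i0 <= i)%N && (j <= j0)%N) mE m i0 j0)%N;
  last first.
  by apply: eq_bigr => i0 _; case: leqP => h //=; rewrite big_pred0.
rewrite -(card_str (fun i0 j0 => (i0 <= i)%N && (j <= j0)%N)); apply: eq_card => s.
rewrite !inE /contains /st /en; case: (s.2 < _)%N => //=; lia.
Qed.

Lemma orbit_normal : Defs.orbit m normal_rep.
Proof.
apply/forallP => i; apply/forallP => j; apply/implyP => lij.
have liN : (i <= N)%N by rewrite -ltnS.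
have ljN : (j <= N)%N by rewrite -ltnS.
rewrite pathmx_normal ?(ltnW lij) // -(card_rk (ltnW lij)).
set A := [pred s | _].
(* Rank factorization through the strings containing both i and j; the transposes are one-sided
   inverses of the factors. *)
pose U : 'M[CC]_(dn j, #|A|) := \matrix_(a, b) (lab a == enum_val b)%:R.
pose V : 'M[CC]_(#|A|, dn i) := \matrix_(b, c) (enum_val b == lab c)%:R.
have -> : \matrix_(a < dn j, c < dn i) (lab a == lab c)%:R = U *m V.
  apply/matrixP => a c; rewrite !mxE; have [e|ne] := eqVneq (lab a) (lab c).
    have hA : lab a \in A by rewrite inE {1}e !has_lab.
    have [b0 eb0] : exists b0 : 'I_#|A|, enum_val b0 = lab a.
      by exists (enum_rank_in hA (lab a)); rewrite enum_rankK_in.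
    rewrite (bigD1 b0) //= !mxE eb0 eqxx e eqxx mul1r big1 ?addr0 // => b ne; rewrite !mxE.
    by rewrite -e -eb0 !(inj_eq enum_val_inj) (negbTE ne) mulr0.
  rewrite big1 // => b _; rewrite !mxE; case: eqP => [<-|]; last by rewrite mul0r.
  by rewrite (negbTE ne) mulr0.
have UU : U^T *m U = 1%:M.
  apply/matrixP => b b'; rewrite !mxE.
  under eq_bigr => a _ do rewrite !mxE.
  rewrite (big_lab _ (fun s => (s == enum_val b)%:R * (s == enum_val b')%:R)) //.
  have := enum_valP b; rewrite inE => /andP[_ hb].
  rewrite (bigD1 (enum_val b)) //= eqxx mul1r (inj_eq enum_val_inj) big1 ?addr0 // => s /andP[_
    /negbTE ->].
  by rewrite mul0r.
have VV : V *m V^T = 1%:M.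
  apply/matrixP => b b'; rewrite !mxE.
  under eq_bigr => a _ do rewrite !mxE.
  rewrite (big_lab _ (fun s => (enum_val b == s)%:R * (enum_val b' == s)%:R)) //.
  have := enum_valP b; rewrite inE => /andP[hb _].
  rewrite (bigD1 (enum_val b)) //= eqxx mul1r (inj_eq enum_val_inj) eq_sym big1 ?addr0 // => s
    /andP[_].
  by rewrite eq_sym => /negbTE ->; rewrite mul0r.
rewrite mxrankMfree; last by apply/row_freeP; exists V^T.
by rewrite -mxrank_tr; apply/row_freeP; exists U.
Qed.

End Strings.

(** * Tangent directions at the normal form *)

Section FirstOrder.
Variable F : fieldType.

(** [cf0] and [cf1] compute modulo ['X^2], that is, over the dual numbers. *)
Definition cf0 m n (A : 'M[{poly F}]_(m, n)) : 'M[F]_(m, n) := map_mx (coefp 0) A.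
Definition cf1 m n (A : 'M[{poly F}]_(m, n)) : 'M[F]_(m, n) := map_mx (coefp 1) A.

Lemma cf0_mul m n l (A : 'M[{poly F}]_(m, n)) (B : 'M_(n, l)) : cf0 (A *m B) = cf0 A *m cf0 B.
Proof. exact: map_mxM. Qed.

Lemma cf1_mul m n l (A : 'M[{poly F}]_(m, n)) (B : 'M_(n, l)) :
  cf1 (A *m B) = cf0 A *m cf1 B + cf1 A *m cf0 B.
Proof.
apply/matrixP => i j; rewrite !mxE /= coef_sum -big_split /=.
apply: eq_bigr => k _; rewrite !mxE /= coefM !big_ord_recl big_ord0 /= addr0.
by [].
Qed.

Lemma cf0_const m n (A : 'M[F]_(m, n)) : cf0 (map_mx polyC A) = A.
Proof. by apply/matrixP => i j; rewrite !mxE /= coefC. Qed.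

Lemma cf1_const m n (A : 'M[F]_(m, n)) : cf1 (map_mx polyC A) = 0.
Proof. by apply/matrixP => i j; rewrite !mxE /= coefC. Qed.

Variables (n n' : nat) (xi : 'M[F]_n) (xi' : 'M[F]_n').

Definition near1 k (y : 'M[F]_k) : 'M[{poly F}]_k := 1%:M + 'X *: map_mx polyC y.

Lemma cf0_near1 k (y : 'M[F]_k) : cf0 (near1 y) = 1%:M.
Proof. by apply/matrixP => i j; rewrite !mxE /= coefD coefMn coefC coefXM eqxx addr0. Qed.

Lemma cf1_near1 k (y : 'M[F]_k) : cf1 (near1 y) = y.
Proof.
apply/matrixP => i j; rewrite !mxE /= coefD coefMn coefC coefXM /= coefC /=.
by rewrite mul0rn add0r.
Qed.

Lemma det_near1_0 k (y : 'M[F]_k) : (\det (near1 y))`_0 = 1.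
Proof.
transitivity (coefp 0 (\det (near1 y))); first by [].
by rewrite -det_map_mx -/(cf0 _) cf0_near1 det1.
Qed.

Lemma cf0_adj k (y : 'M[F]_k) : cf0 (\adj (near1 y)) = 1%:M.
Proof.
have := congr1 (@cf0 k k) (mul_adj_mx (near1 y)); rewrite cf0_mul cf0_near1 mulmx1 => ->.
by apply/matrixP => i j; rewrite !mxE /= coefMn det_near1_0.
Qed.

(** The derivative of the determinant at the identity, that is, the trace of y. *)
Definition tr1 k (y : 'M[F]_k) : F := (\det (near1 y))`_1.

(** Obtained by differentiating [\adj B *m B = (\det B)%:M] at the identity. *)
Lemma cf1_adj k (y : 'M[F]_k) : cf1 (\adj (near1 y)) = (tr1 y)%:M - y.
Proof.
have := congr1 (@cf1 k k) (mul_adj_mx (near1 y)).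
rewrite cf1_mul cf0_near1 cf0_adj cf1_near1 mulmx1 mul1mx => e.
have e2 : cf1 ((\det (near1 y))%:M : 'M_k) = (tr1 y)%:M :> 'M_k by apply/matrixP => i j;
  rewrite !mxE /= coefMn.
by rewrite -e2 -e [y + _]addrC addrK.
Qed.

(* The scalar factor cancels the derivative of the determinant, so that the tangent vector at 0
   is xi' A - A xi. *)
Definition curve (A : 'M[F]_(n', n)) : 'M[{poly F}]_(n', n) :=
  (1 - (tr1 xi)%:P * 'X) *: (near1 xi' *m map_mx polyC A *m \adj (near1 xi)).

Lemma cf0_curve A : cf0 (curve A) = A.
Proof.
have E c (Z : 'M[{poly F}]_(n', n)) : cf0 ((1 - c%:P * 'X) *: Z) = cf0 Z.
  apply/matrixP => i j; rewrite !mxE /=.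
  by rewrite mulrBl mul1r coefB -mulrA coefCM coefXM /= mulr0 subr0.
by rewrite E !cf0_mul cf0_const cf0_near1 cf0_adj mul1mx mulmx1.
Qed.

Lemma cf1_curve A : cf1 (curve A) = xi' *m A - A *m xi.
Proof.
have E c (Z : 'M[{poly F}]_(n', n)) : cf1 ((1 - c%:P * 'X) *: Z) = cf1 Z - c *: cf0 Z.
  apply/matrixP => i j; rewrite !mxE /=.
  by rewrite mulrBl mul1r coefB -mulrA coefCM coefXM.
rewrite E !cf0_mul !cf1_mul !cf0_mul cf0_const cf1_const cf0_near1 cf0_adj cf1_near1 cf1_adj.
rewrite !(mul1mx, mulmx1, mulmx0, add0r) mulmxBr mul_mx_scalar.
by rewrite addrAC [_ - _ - _]addrAC subrr add0r addrC.
Qed.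

(** Multiplication by [near1 xi] turns the adjugate into a determinant; this is the relation that
    [rank_pathmx_gauge] takes as hypothesis. *)
Lemma curve_gauge A (e : F) :
  map_mx (horner_eval e) (curve A) *m map_mx (horner_eval e) (near1 xi) =
  ((1 - tr1 xi * e) * (\det (near1 xi)).[e]) *: (map_mx (horner_eval e) (near1 xi') *m A).
Proof.
rewrite -map_mxM /curve -scalemxAl -mulmxA mul_adj_mx mul_mx_scalar scalerA.
apply/matrixP => i j; rewrite !mxE /= /horner_eval hornerM; congr (_ * _).
  by rewrite !hornerE.
rewrite horner_sum; apply: eq_bigr => k _.
by rewrite hornerM !mxE /= hornerC.
Qed.

End FirstOrder.

Section LowerBound.
Variables (N : nat) (d : 'I_N.+1 -> nat) (m : KP d).
Hypothesis km : kostant m.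
Local Notation dn := (dn d).
Local Notation strT := ('I_N.+1 * 'I_N.+1 * 'I_(bnd d))%type.
Local Notation lab := (@lab N d m _).

(* The entries of A_(k+1) in row t and column s, where the string s ends at k and t starts after s;
   they span a complement of the tangent space of the orbit at the normal form. *)
Definition bad (v : Var d) : bool :=
  (en (lab (tagged v).2) == tag v) && (st (lab (tagged v).2) < st (lab (tagged v).1))%N.

Definition free_coords : {set 'I_(nv d)} := [set i | ~~ bad (enum_val i)].

Section Tangent.
Variable v : Var d -> CC.

(** Indexed by strings, the entries of v at successive k become comparable for a fixed pair (t, s).
    The value is 0 when t misses k + 1 or s misses k. *)
Definition dir (k : nat) (t s : strT) : CC :=
  \sum_(a < dn k.+1) \sum_(c < dn k) vmat v k a c *+ ((lab a == t) && (lab c == s)).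

Lemma dir_lab k (hk : (k < N)%N) a c : dir k (lab a) (lab c) = v (var hk a c).
Proof.
rewrite /dir (bigD1 a) //= [X in _ + X]big1 ?addr0 => [|a' ne]; last first.
  by apply: big1 => c' _; rewrite lab_inj // (negbTE ne).
rewrite (bigD1 c) //= [X in _ + X]big1 ?addr0 => [|c' ne]; last first.
  by rewrite eqxx lab_inj ?(ltnW hk) // (negbTE ne).
by rewrite !eqxx (vmatE _ hk).
Qed.

(* Telescoping along the strings: backwards when t starts before s, forwards otherwise. *)
Definition potential (k : nat) (t s : strT) : CC :=
  if (st t <= st s)%N then - \sum_(k <= l < N | (l <= en s)%N && (l < en t)%N) dir l t s
  else \sum_(0 <= l < k | (st t <= l.+1)%N) dir l t s.

Definition xi (k : nat) : 'M[CC]_(dn k) := \matrix_(a, c) potential k (lab a) (lab c).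

Lemma xi_tangent k (hk : (k < N)%N) a c : ~~ bad (var hk a c) ->
  (xi k.+1 *m Amat (normal_rep m) k - Amat (normal_rep m) k *m xi k) a c = v (var hk a c).
Proof.
move=> nb; rewrite -dir_lab mxE [X in _ + X]mxE !mxE.
have ht := has_lab km a hk; have hs := has_lab km c (ltnW hk).
have -> : \sum_j xi k.+1 a j * Amat (normal_rep m) k j c =
    if contains m k.+1 (lab c) then potential k.+1 (lab a) (lab c) else 0.
  under eq_bigr => b _ do rewrite mxE Amat_normal //.
  rewrite (big_lab km _ (fun s => potential k.+1 (lab a) s * (s == lab c)%:R)) //.
  case: ifP => h.
    rewrite (bigD1 (lab c)) //= eqxx mulr1 big1 ?addr0 // => s /andP[_ /negbTE ->].
    by rewrite mulr0.
  rewrite big1 // => s h2; case: eqP => [e|]; last by rewrite mulr0.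
  by rewrite e h in h2.
have -> : \sum_j Amat (normal_rep m) k a j * xi k j c =
    if contains m k (lab a) then potential k (lab a) (lab c) else 0.
  under eq_bigr => b _ do rewrite Amat_normal // mxE.
  rewrite (big_lab km _ (fun s => (lab a == s)%:R * potential k s (lab c))) ?(ltnW hk) //.
  case: ifP => h.
    rewrite (bigD1 (lab a)) //= eqxx mul1r big1 ?addr0 // => s /andP[_].
    by rewrite eq_sym => /negbTE ->; rewrite mul0r.
  rewrite big1 // => s h2; case: eqP => [e|]; last by rewrite mul0r.
  by rewrite -e h in h2.
move: nb; rewrite /bad /= -/(lab a) -/(lab c); set t := lab a; set s := lab c.
move: ht hs; rewrite -/t -/s /contains => /andP[-> ht] /andP[-> hs] /= nb.
rewrite /potential; case: (leqP (st t) (st s)) => cmp.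
  (* Here t passes through k. If s ends at k, the backward sum at k is its single term l = k. *)
  have -> : (st t <= k <= en t)%N by lia.
  rewrite opprK [in X in _ + X = _]big_ltn_cond //.
  have -> : (k <= en s)%N && (k < en t)%N by lia.
  case: ifP => h; first by rewrite addrC -addrA subrr addr0.
  rewrite add0r big_nat_cond big_pred0 ?addr0 // => l; lia.
(* Here [nb] forces s to continue to k + 1. If t starts at k + 1, the forward sum at k + 1 is its
   single term l = k. *)
have -> : (st s <= k.+1 <= en s)%N by lia.
have e : \sum_(0 <= l < k.+1 | (st t <= l.+1)%N) dir l t s =
         \sum_(0 <= l < k | (st t <= l.+1)%N) dir l t s + dir k t s.
  rewrite big_mkcond big_nat_recr //= -big_mkcond /=.
  by have -> : (st t <= k.+1)%N by lia.
rewrite e; case: ifP => h; first by rewrite addrC addKr.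
rewrite subr0 big_nat_cond big_pred0 ?add0r // => l; lia.
Qed.
End Tangent.

Lemma horner_mmap n (h : 'I_n -> {poly CC}) (p : {mpoly CC[n]}) (e : CC) :
  (mmap (@polyC CC) h p).[e] = p.@[fun i => (h i).[e]].
Proof.
rewrite mevalE /mmap horner_sum; apply: eq_bigr => mo _.
rewrite hornerM hornerC /mmap1 horner_prod; congr (_ * _).
by apply: eq_bigr => i _; rewrite horner_exp.
Qed.

Lemma in_vars_meval (J : {set 'I_(nv d)}) (p : {mpoly CC[nv d]}) x y :
  in_vars J p -> {in J, x =1 y} -> p.@[x] = p.@[y].
Proof.
move=> hp e; rewrite !mevalE big_seq [RHS]big_seq; apply: eq_bigr => mo mp; congr (_ * _).
apply: eq_bigr => i _; have [iJ|iJ] := boolP (i \in J); first by rewrite e.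
by rewrite (hp mo).
Qed.

Lemma curve_orbit (v : Var d -> CC) (e : CC) :
  (forall k, (k <= N)%N -> (1 - tr1 (xi v k) * e) * (\det (near1 (xi v k))).[e] != 0) ->
  Defs.orbit m (rep_of (fun k => map_mx (horner_eval e)
                   (curve (xi v k) (xi v k.+1) (Amat (normal_rep m) k)))).
Proof.
move=> he; set y := rep_of _.
have rk_eq := @rank_pathmx_gauge N d (normal_rep m) y
  (fun k => map_mx (horner_eval e) (near1 (xi v k)))
  (fun k => (1 - tr1 (xi v k) * e) * (\det (near1 (xi v k))).[e]).
apply/forallP => i; apply/forallP => j; apply/implyP => lij.
rewrite rk_eq ?(ltnW lij) -1?ltnS //.
- by have /forallP/(_ i)/forallP/(_ j) := orbit_normal km; rewrite lij.
- move=> k kN; rewrite unitmxE det_map_mx unitfE.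
  by have := he k kN; rewrite mulf_eq0 negb_or => /andP[].
- by move=> k kN; apply: he; apply: ltnW.
- by move=> k kN; rewrite Amat_rep_of // curve_gauge.
Qed.

(** By [xi_tangent], a curve in the orbit leaves the normal form in any prescribed direction of the
    free coordinates, which is what [mpoly_eq0_curves] asks for. *)
Lemma alg_indep_free_coords : alg_indep (Defs.orbit m) free_coords.
Proof.
move=> p pJ pO; apply: (mpoly_eq0_curves pchar_CC (x0 := coords (normal_rep m))) => v.
pose v' (w : Var d) := v (enum_rank w).
pose gam k := curve (xi v' k) (xi v' k.+1) (Amat (normal_rep m) k).
pose g (w : Var d) : {poly CC} := gam (tag w) (tagged w).1 (tagged w).2.
have g0 w : (g w)`_0 = normal_rep m w.
  have := congr1 (fun A : 'M_(_, _) => A (tagged w).1 (tagged w).2)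
    (cf0_curve (xi v' (tag w)) (xi v' (tag w).+1) (Amat (normal_rep m) (tag w))).
  have [k [hk [a [c ew]]]] := varE w; subst w.
  by rewrite /g /= mxE /= Amat_vmat (vmatE _ hk).
have g1 w : ~~ bad w -> (g w)`_1 = v' w.
  have [k [hk [a [c ew]]]] := varE w; subst w => nb.
  rewrite -(xi_tangent v' nb).
  have := congr1 (fun A : 'M_(_, _) => A a c)
    (cf1_curve (xi v' k) (xi v' k.+1) (Amat (normal_rep m) k)).
  by move=> <-; rewrite mxE.
(* Since p does not involve the other coordinates, they may follow a straight line in direction v
   instead of the curve. *)
pose u i : {poly CC} := if i \in free_coords then drop_poly 1 (g (enum_val i)) else (v i)%:P.
exists u => [i|].
  rewrite /u; case: ifP => [|_]; last by rewrite hornerC.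
  by rewrite inE => nb; rewrite horner_coef0 coef_drop_poly g1 // /v' enum_valK.
set h := fun i => _ + _.
(* Where [Delta] is nonzero, all gauge matrices and scalars are invertible and the curve lies in the
   orbit. Multiplying by [Delta], whose value at 0 is 1, disposes of its zeros. *)
pose Delta : {poly CC} :=
  \prod_(k < N.+1) ((1 - (tr1 (xi v' k))%:P * 'X) * \det (near1 (xi v' k))).
have Delta0 : Delta != 0.
  apply/eqP => /(congr1 (horner^~ 0)); rewrite horner0 horner_prod big1 => [/eqP|k _].
    by rewrite oner_eq0.
  by rewrite hornerM horner_coef0 [_.[0]]horner_coef0 det_near1_0 mulr1 coefB coef1 coefCM coefX
    mulr0 subr0.
apply: (mulIf Delta0); rewrite mul0r; apply: (poly_eq0_horner pchar_CC) => e.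
rewrite hornerM horner_mmap; have [De|De] := eqVneq Delta.[e] 0; first by rewrite De mulr0.
apply/eqP; rewrite mulf_eq0 (negbTE De) orbF; apply/eqP.
rewrite -[RHS](pO (rep_of (fun k => map_mx (horner_eval e) (gam k)))).
  apply: (in_vars_meval pJ) => i iJ.
  transitivity ((g (enum_val i)).[e]); last by rewrite /coords ffunE mxE.
  have tk : take_poly 1 (g (enum_val i)) = (coords (normal_rep m) i)%:P.
    by apply/polyP => -[|j]; rewrite coef_take_poly coefC //= g0.
  by rewrite /h /u iJ -[in RHS](poly_take_drop 1 (g (enum_val i))) tk expr1 mulrC.
apply: curve_orbit => k kN; move: De; rewrite horner_prod.
rewrite (bigD1 (Ordinal (kN : (k < N.+1)%N))) //= mulf_eq0 negb_or => /andP[+ _].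
by rewrite hornerM !hornerE.
Qed.
End LowerBound.

(** * Adapted bases *)

Section RelativeIndependence.
Variables (F : fieldType) (I : finType) (n : nat).

Definition indep_mod (W : 'M[F]_n) (v : I -> 'rV[F]_n) (B : {set I}) : Prop :=
  forall lam : I -> F, ((\sum_(s in B) lam s *: v s)%R <= W)%MS -> forall s, s \in B -> lam s = 0.

Lemma eq_in_indep_mod (W : 'M[F]_n) (f g : I -> 'rV[F]_n) (B : {set I}) :
  {in B, f =1 g} -> indep_mod W f B -> indep_mod W g B.
Proof.
move=> e iB lam h; apply: iB; rewrite (eq_bigr (fun s => lam s *: g s)) // => s sB.
by rewrite e.
Qed.

(** Basis extension modulo W. The new vectors are recorded as row indices of M, not as vectors, so
    that only finitely many choices exist. *)
Lemma indep_mod_extend b (W : 'M[F]_n) (M : 'M[F]_(b, n)) (f : I -> 'rV[F]_n) (A B : {set I}) :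
  B \subset A -> (\rank W + #|A| <= \rank (W + M)%MS)%N -> indep_mod W f B ->
  exists r : I -> option 'I_b, (forall s, s \in B -> r s = None) /\
    indep_mod W (fun s => if r s is Some a then row a M else f s) A.
Proof.
move=> sBA leA iB.
suff H k : forall B' (r : I -> option 'I_b), #|A :\: B'| = k -> B \subset B' -> B' \subset A ->
    (forall s, s \in B -> r s = None) ->
    indep_mod W (fun s => if r s is Some a then row a M else f s) B' ->
  exists r : I -> option 'I_b, (forall s, s \in B -> r s = None) /\
    indep_mod W (fun s => if r s is Some a then row a M else f s) A.
  exact: (H _ B (fun=> None) erefl).
elim: k => [|k IH] B' r.
  move/eqP; rewrite cards_eq0 setD_eq0 => sAB' _ sB'A rN iB'.
  have <- : B' = A by apply/eqP; rewrite eqEsubset sB'A.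
  by exists r.
move=> cA sBB' sB'A rN iB'.
have /card_gt0P[s0] : (0 < #|A :\: B'|)%N by rewrite cA.
rewrite inE => /andP[s0B' s0A].
pose v s := if r s is Some a then row a M else f s.
pose S := (W + \sum_(s in B') <<v s>>)%MS.
have [a aS] : exists a : 'I_b, ~~ (row a M <= S)%MS.
  apply/existsP; rewrite -negb_forall; apply/negP => /forallP h.
  have /row_subP MS : forall a, (row a M <= S)%MS := h.
  have : (\rank (W + M)%MS <= \rank W + #|B'|)%N.
    apply: (leq_trans (mxrankS (_ : (W + M <= S)%MS))); first by rewrite addsmx_sub addsmxSl.
    rewrite (leq_trans (mxrank_adds_leqif _ _)) // leq_add2l.
    rewrite (leq_trans (mxrank_sum_leqif _)) //= -sum1_card leq_sum // => s _.
    by rewrite genmxE rank_leq_row.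
  have : (#|B'| < #|A|)%N by rewrite -(cardsID B' A) (setIidPr sB'A) cA addnS ltnS leq_addr.
  by move=> h1 h2; have := leq_trans leA h2; rewrite leq_add2l leqNgt h1.
apply: (IH (s0 |: B') (fun s => if s == s0 then Some a else r s)).
- have -> : A :\: (s0 |: B') = (A :\: B') :\ s0.
    by apply/setP => s; rewrite !inE negb_or andbA.
  by move: cA; rewrite (cardsD1 s0) inE s0B' s0A add1n => -[].
- exact: subset_trans sBB' (subsetUr _ _).
- by rewrite subUset sub1set s0A.
- by move=> s sB; rewrite ifN ?rN //; apply: contraNneq s0B' => <-; apply: (subsetP sBB').
move=> lam; rewrite big_setU1 //= eqxx => h.
have e : \sum_(s in B') lam s *: (if (if s == s0 then Some a else r s) is Some a then row a M
  else f s) =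
         \sum_(s in B') lam s *: v s.
  by apply: eq_bigr => s sB; rewrite ifN //; apply: contraNneq s0B' => <-.
rewrite {}e in h.
have l0 : lam s0 = 0.
  apply/eqP; apply: contraNT aS => l0.
  have : (lam s0 *: row a M <= S)%MS.
    rewrite -[_ *: _](addrK (\sum_(s in B') lam s *: v s)) addmx_sub //.
      exact: submx_trans h (addsmxSl _ _).
    rewrite eqmx_opp summx_sub // => s sB; apply: scalemx_sub.
    apply: submx_trans (addsmxSr _ _); apply: submx_trans (sumsmx_sup s _ (submx_refl _)) => //.
    by rewrite genmxE.
  by rewrite eqmx_scale.
move=> s; rewrite in_setU1 => /orP[/eqP ->|] //.
by apply: iB'; rewrite l0 scale0r add0r in h.
Qed.

End RelativeIndependence.

Section AdaptedBasis.
Variables (N : nat) (d : 'I_N.+1 -> nat) (m : KP d).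
Hypothesis km : kostant m.
Local Notation dn := (dn d).
Local Notation strT := ('I_N.+1 * 'I_N.+1 * 'I_(bnd d))%type.
Local Notation lab := (@lab N d m _).
Local Notation through := (contains m).
Variable x : Rep d.
Hypothesis xO : Defs.orbit m x.

Definition img i j : 'M[CC]_(dn i, dn j) := (pathmx x i j)^T.

(** The images at j of the vertices before i form an increasing flag, so that of i - 1 contains them
    all; [<<_>>] makes the size independent of i. *)
Definition img_lt i j : 'M[CC]_(dn j) := if i is i'.+1 then <<img i' j>>%MS else 0.

Lemma img_id i : img i i = 1%:M.
Proof. by rewrite /img pathmx_id trmx1. Qed.

Lemma img_trans i j k : (i <= j)%N -> (j <= k)%N -> img i k = img i j *m img j k.
Proof. by move=> lij ljk; rewrite /img (pathmx_trans x lij ljk) trmx_mul. Qed.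

Lemma img_sub i k j : (i <= k)%N -> (k <= j)%N -> (img i j <= img k j)%MS.
Proof. by move=> lik lkj; rewrite (img_trans lik lkj) submxMl. Qed.

Lemma img_lt_sub i k j : (i <= k)%N -> (k <= j.+1)%N -> (img_lt i j <= img_lt k j)%MS.
Proof.
case: i => [|i]; first by rewrite sub0mx.
by case: k => // k lik lkj; rewrite /= genmxE genmxE img_sub.
Qed.

Lemma rank_img i j : (i <= j)%N -> (j <= N)%N ->
  \rank (img i j) = #|[pred s | through j s && (st s <= i)%N]|.
Proof.
move=> lij ljN; have liN := leq_trans lij ljN.
transitivity #|[pred s | through i s && through j s]|; last first.
  apply: eq_card => s; rewrite !inE /contains; case: (_ < _)%N => //=.
  by apply/idP/idP; lia.
rewrite mxrank_tr; move: lij; rewrite leq_eqVlt => /orP[/eqP e|lij].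
  subst j; rewrite pathmx_id mxrank1 -(card_contains km liN).
  by apply: eq_card => s; rewrite !inE andbb.
have := card_rk km (i := inord i) (j := inord j); rewrite !inordK ?ltnS // => -> //;
  last exact: ltnW.
have /forallP/(_ (inord i))/forallP/(_ (inord j)) := xO.
by rewrite !inordK ?ltnS // lij => /eqP.
Qed.

Lemma rank_img_lt i j : (i <= j.+1)%N -> (j <= N)%N ->
  \rank (img_lt i j) = #|[pred s | through j s && (st s < i)%N]|.
Proof.
case: i => [|i] lij ljN; last by rewrite /= genmxE rank_img.
by rewrite mxrank0 eq_card0 // => s; rewrite !inE ltn0 andbF.
Qed.

Lemma img_step i j : (i <= j)%N -> img i j *m (Amat x j)^T = img i j.+1.
Proof. by move=> lij; rewrite /img pathmxS // trmx_mul. Qed.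

Lemma img_lt_step i j : (i <= j.+1)%N -> (img_lt i j *m (Amat x j)^T <= img_lt i j.+1)%MS.
Proof.
case: i => [|i] lij; first by rewrite mul0mx sub0mx.
by rewrite /= (eqmxMr _ (genmxE _)) img_step // genmxE.
Qed.

(** The index is a plain number so that one function [sg] serves vertices of different dimensions;
    out of range, the row is 0. *)
Definition erow n (a : nat) : 'rV[CC]_n := \row_b (b == a :> nat)%:R.

Lemma erow_mul n l (a : 'I_n) (M : 'M[CC]_(n, l)) : erow n a *m M = row a M.
Proof.
have -> : erow n a = delta_mx 0 a by apply/rowP => b; rewrite !mxE eqxx.
by rewrite rowE.
Qed.

Definition hvec (sg : strT -> 'I_(bnd d)) j (s : strT) : 'rV[CC]_(dn j) :=
  erow _ (sg s) *m img (st s) j.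

Definition starting i j : {set strT} := [set s | through j s && (st s == i)].

Lemma en_le (s : strT) : (en s <= N)%N.
Proof. by rewrite -ltnS ltn_ord. Qed.

(** The vectors at i are chosen first for the strings that reach furthest, by descending j: those
    reaching j + 1 are already independent at j, and the family is extended by the strings ending at
    j. *)
Lemma exists_adapted_row i : (i <= N)%N ->
  exists sg : strT -> 'I_(bnd d), forall j, (i <= j <= N)%N ->
    indep_mod (img_lt i j) (hvec sg j) (starting i j).
Proof.
move=> liN.
suff H n : forall j, (N.+1 - j = n)%N -> (i <= j <= N.+1)%N ->
  exists sg : strT -> 'I_(bnd d), forall j', (j <= j' <= N)%N ->
    indep_mod (img_lt i j') (hvec sg j') (starting i j').
  have [|sg hsg] := H _ i erefl; first by rewrite leqnn ltnW.
  by exists sg => j hj; apply: hsg.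
elim: n => [|n IH] j ej /andP[lij ljN].
  by exists (fun=> ord0) => j' /andP[h1 h2]; lia.
have {}ljN : (j <= N)%N by lia.
have [||sg hsg] := IH j.+1; [lia|lia|].
have sub : starting i j.+1 \subset starting i j.
  by apply/subsetP => s; rewrite !inE /contains => /andP[/andP[-> h1] h2] /=; lia.
(* A relation at j is mapped by A_(j+1) to a relation at j + 1, so independence pulls back. For j =
   N the family is empty. *)
have i1 : indep_mod (img_lt i j) (hvec sg j) (starting i j.+1).
  move=> lam h; have [lt|ge] := ltnP j N; last first.
    by move=> s; rewrite inE /contains => /andP[/andP[_ h1] h2]; have h3 := en_le s; exfalso; lia.
  apply: (hsg j.+1); first by lia.
  have -> : \sum_(s in starting i j.+1) lam s *: hvec sg j.+1 s =
            (\sum_(s in starting i j.+1) lam s *: hvec sg j s) *m (Amat x j)^T.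
    rewrite mulmx_suml; apply: eq_bigr => s.
    by rewrite inE => /andP[_ /eqP e]; rewrite -scalemxAl /hvec -mulmxA img_step // e.
  exact: submx_trans (submxMr _ h) (img_lt_step (leqW lij)).
(* The strings starting at i account exactly for the jump of rank from [img_lt i j] to [img i j]. *)
have rk : (\rank (img_lt i j) + #|starting i j| <= \rank (img_lt i j + img i j)%MS)%N.
  apply: (@leq_trans (\rank (img i j))); last by rewrite mxrankS // addsmxSr.
  rewrite rank_img_lt ?rank_img //; last exact: leqW.
  rewrite -[X in (X + _)%N]cardsE -[X in (_ <= X)%N]cardsE -cardsUI [X in (_ + X)%N](_ : _ = 0%N)
    ?addn0.
    apply/subset_leq_card/subsetP => s; rewrite !inE; case: (through j s) => //=; lia.
  apply/eqP; rewrite cards_eq0; apply/eqP/setP => s; rewrite !inE; case: (through j s) => //=; lia.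
have [r [rN ir]] := indep_mod_extend sub rk i1.
pose up (a : 'I_(dn i)) : 'I_(bnd d) := Ordinal (ltn_trans (ltn_ord a) (dn_lt_bnd d i)).
exists (fun s => if r s is Some a then up a else sg s) => j' /andP[];
  rewrite leq_eqVlt => /orP[/eqP <-|lt] lj'.
  apply: eq_in_indep_mod ir => s; rewrite inE /hvec => /andP[_ /eqP e].
  case: (r s) => [a|] //; rewrite -erow_mul -[RHS]/(erow _ a *m _).
  by move: (st s) e => i0 e; subst i0.
(* A string from i through j' > j passes through j + 1, so its vector was left unchanged. *)
apply: (eq_in_indep_mod _ (hsg j' _)); last by rewrite lt.
move=> s sj'; rewrite /hvec rN //; move: sj'; rewrite !inE /contains => /andP[/andP[-> h1] h2]
  /=; rewrite h2; lia.
Qed.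

(** A finite function, so that the possible choices form a finite type over which relations can be
    multiplied. *)
Lemma exists_adapted :
  exists sg : {ffun strT -> 'I_(bnd d)}, forall i j, (i <= j <= N)%N ->
    indep_mod (img_lt i j) (hvec sg j) (starting i j).
Proof.
have [sg hsg] : exists sg : 'I_N.+1 -> (strT -> 'I_(bnd d)), forall i : 'I_N.+1, forall j, (i <=
  j <= N)%N ->
    indep_mod (img_lt i j) (hvec (sg i) j) (starting i j).
  apply: (@fin_all_exists _ (fun=> strT -> 'I_(bnd d)) (fun (i : 'I_N.+1) sg =>
    forall j, (i <= j <= N)%N -> indep_mod (img_lt i j) (hvec sg j) (starting i j))) => i.
  by apply: exists_adapted_row; rewrite -ltnS.
exists [ffun s => sg s.1.1 s] => i j ij.
have iN : (i < N.+1)%N by lia.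
apply: eq_in_indep_mod (hsg (Ordinal iN) j ij) => s.
rewrite inE => /andP[_ /eqP e]; rewrite /hvec ffunE.
by have -> : s.1.1 = Ordinal iN by apply/val_inj.
Qed.

Variable sg : strT -> 'I_(bnd d).
Hypothesis sgP : forall i j, (i <= j <= N)%N -> indep_mod (img_lt i j) (hvec sg j) (starting i j).

(** By descending start k: later strings have coefficient 0 already, earlier ones lie in
    [img_lt k j], and those starting at k are independent modulo it. With i = 0 it shows that the
    vectors form a basis. *)
Lemma hvec_triangular i j (lam : strT -> CC) : (i <= j.+1)%N -> (j <= N)%N ->
  ((\sum_(t | through j t) lam t *: hvec sg j t)%R <= img_lt i j)%MS ->
  forall t, through j t -> (i <= st t)%N -> lam t = 0.
Proof.
move=> lij ljN h.
suff H n : forall k, (j.+1 - k = n)%N -> (i <= k <= j.+1)%N ->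
    forall t, through j t -> (k <= st t)%N -> lam t = 0.
  by apply: (H _ i erefl); rewrite leqnn.
elim: n => [|n IH] k ek /andP[lik lkj] t ht lkt.
  by move: ht; rewrite /contains => /andP[_ ht]; exfalso; lia.
have {}lkj : (k <= j)%N by lia.
have z t' : through j t' -> (k < st t')%N -> lam t' = 0 by apply: IH; lia.
move: lkt; rewrite leq_eqVlt => /orP[/eqP e|]; last exact: z.
have kjN : (k <= j <= N)%N by rewrite lkj.
have tS : t \in starting k j by rewrite inE ht e eqxx.
apply: (sgP kjN _ tS).
have -> : \sum_(s in starting k j) lam s *: hvec sg j s =
    \sum_(t | through j t) lam t *: hvec sg j t -
    \sum_(t | through j t && (st t < k)%N) lam t *: hvec sg j t.
  rewrite [X in X - _](bigID (fun t => (st t < k)%N)) /= addrAC subrr add0r.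
  rewrite [RHS](bigID (fun t => st t == k)) /= [X in _ + X]big1 ?addr0.
    by apply: eq_bigl => s; rewrite inE; case: (through j s) => //=; lia.
  by move=> s hs; rewrite z ?scale0r //; lia.
rewrite addmx_sub ?eqmx_opp //.
  by apply: submx_trans h _; apply: img_lt_sub => //; lia.
apply: summx_sub => s /andP[hs lts]; apply: scalemx_sub.
apply: submx_trans (submxMl _ _) _; apply: (@submx_trans _ _ _ _ _ _ (img_lt (st s).+1 j)).
  by rewrite /= genmxE.
by apply: img_lt_sub; lia.
Qed.

End AdaptedBasis.

(** * Rational parametrization of an orbit and its dimension *)

Section Parametrization.
Variables (N : nat) (d : 'I_N.+1 -> nat) (m : KP d).
Hypothesis km : kostant m.
Local Notation dn := (dn d).
Local Notation strT := ('I_N.+1 * 'I_N.+1 * 'I_(bnd d))%type.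
Local Notation lab := (@lab N d m _).
Local Notation through := (contains m).

Section Model.
Variables (R : comNzRingType) (th : Var d -> R) (sg : strT -> 'I_(bnd d)).

(* Transposes of the basis matrix at j and of the matrix of A_(k+1) applied to the basis at k,
   as functions of the free parameters th. *)
Definition par_basis (j : nat) : 'M[R]_(dn j) :=
  match j with
  | 0 => \matrix_(b, a) (a == sg (lab b) :> nat)%:R
  | k.+1 => \matrix_(b, a) if st (lab b) == k.+1 then (a == sg (lab b) :> nat)%:R
                           else \sum_(c < dn k) vmat th k a c *+ (lab c == lab b)
  end.

Definition par_image (k : nat) : 'M[R]_(dn k, dn k.+1) :=
  \matrix_(c, a) if en (lab c) == k then \sum_(a' < dn k.+1) vmat th k a' c * par_basis k.+1 a' a
                 else vmat th k a c.
End Model.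

#[local] Arguments par_basis : simpl never.

Lemma vmat_map (R S : comNzRingType) (phi : {rmorphism R -> S}) (th : Var d -> R) (th' : Var d ->
  S) k a c :
  (k < N)%N -> (forall v, phi (th v) = th' v) -> phi (vmat th k a c) = vmat th' k a c.
Proof. by move=> hk e; rewrite !(vmatE _ hk). Qed.

(** To be used with [phi] the evaluation of polynomials: the generic matrix specializes to that of a
    given point. *)
Lemma par_basis_map (R S : comNzRingType) (phi : {rmorphism R -> S}) th th' sg j :
  (j <= N)%N -> (forall v, phi (th v) = th' v) ->
  map_mx phi (par_basis th sg j) = par_basis th' sg j.
Proof.
case: j => [|k] jN e; apply/matrixP => b a; rewrite !mxE ?rmorph_nat //.
case: ifP => _; first by rewrite rmorph_nat.
rewrite rmorph_sum; apply: eq_bigr => c _.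
by rewrite rmorphMn /= (vmat_map _ _ jN e).
Qed.

Lemma par_image_map (R S : comNzRingType) (phi : {rmorphism R -> S}) th th' sg k :
  (k < N)%N -> (forall v, phi (th v) = th' v) ->
  map_mx phi (par_image th sg k) = par_image th' sg k.
Proof.
move=> kN e; apply/matrixP => c a; rewrite [LHS]mxE [in LHS]mxE [RHS]mxE.
case: ifP => _; last exact: vmat_map.
rewrite rmorph_sum; apply: eq_bigr => a' _.
by rewrite rmorphM /= (vmat_map _ _ kN e) -(par_basis_map sg kN e) [in RHS]mxE.
Qed.

Section Point.
Variables (x : Rep d) (sg : strT -> 'I_(bnd d)).
Hypothesis xO : Defs.orbit m x.
Hypothesis sgP : forall i j, (i <= j <= N)%N ->
  indep_mod (img_lt x i j) (hvec x sg j) (starting m i j).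

Definition hmx j : 'M[CC]_(dn j) := \matrix_(b < dn j) hvec x sg j (lab b).

Definition lab_coef j (u : 'rV[CC]_(dn j)) (t : strT) : CC := \sum_a u 0 a *+ (lab a == t).

Lemma lab_coefE j (u : 'rV[CC]_(dn j)) a : (j <= N)%N -> lab_coef u (lab a) = u 0 a.
Proof.
move=> jN; rewrite /lab_coef (bigD1 a) //= eqxx big1 ?addr0 // => b ne.
by rewrite lab_inj // (negbTE ne).
Qed.

Lemma mul_hmx j (u : 'rV[CC]_(dn j)) : (j <= N)%N ->
  u *m hmx j = \sum_(t | through j t) lab_coef u t *: hvec x sg j t.
Proof.
move=> jN; rewrite -(big_lab km _ (fun t => lab_coef u t *: hvec x sg j t)) // mulmx_sum_row.
by apply: eq_bigr => a _; rewrite rowK lab_coefE.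
Qed.

Lemma hmx_unit j : (j <= N)%N -> hmx j \in unitmx.
Proof.
move=> jN; rewrite -row_free_unit; apply: inj_row_free => u u0.
apply/rowP => a; rewrite mxE -lab_coefE //.
apply: (hvec_triangular km xO sgP (i := 0) (j := j)); rewrite ?has_lab //.
by rewrite -mul_hmx // u0 sub0mx.
Qed.

(** The parameters of the point x. In the column of a string s ending at k they are the coefficients
    of the image of s in the basis at k + 1; otherwise that image is itself a basis vector, and they
    are its entries. *)
Definition par_of (v : Var d) : CC :=
  let s := lab (tagged v).2 in
  if en s == tag v then (hvec x sg (tag v).+1 s *m invmx (hmx (tag v).+1)) 0 (tagged v).1
  else hvec x sg (tag v).+1 s 0 (tagged v).1.

(** The image of s comes from the vertex [st s], so by triangularity it has no component on strings
    starting later. *)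
Lemma par_of_bad v : bad m v -> par_of v = 0.
Proof.
have [k [hk [a [c ->]]]] := varE v; rewrite /bad /par_of /= => /andP[-> lt].
set u := _ *m _; rewrite -(lab_coefE u a hk).
apply: (hvec_triangular km xO sgP (i := (st (lab c)).+1) (j := k.+1)); rewrite ?has_lab //.
  by rewrite ltnS; have /andP[_ /andP[+ _]] := has_lab km c (ltnW hk); apply: leqW.
rewrite -mul_hmx // /u mulmxKV ?hmx_unit //=.
by rewrite genmxE /hvec submxMl.
Qed.

Lemma hvec_start k s : st s = k -> hvec x sg k s = erow _ (sg s).
Proof.
rewrite /hvec; move: (st s) => i e; subst i.
by rewrite img_id mulmx1.
Qed.

Lemma par_basis_hmx j : (j <= N)%N -> par_basis par_of sg j = hmx j.
Proof.
case: j => [|k] jN; apply/matrixP => b a; rewrite [LHS]mxE [RHS]mxE.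
  have := has_lab km b jN; rewrite /contains leqn0 => /andP[_ /andP[/eqP e _]].
  by rewrite hvec_start // mxE.
case: eqP => e; first by rewrite hvec_start // mxE.
have hb := has_lab km b jN.
have hk : through k (lab b) by move: hb; rewrite /contains => /andP[-> /=]; lia.
have [c ec] := lab_surj km (ltnW jN) hk.
rewrite (bigD1 c) //= ec eqxx big1 ?addr0 => [|c' ne]; last first.
  by rewrite -ec lab_inj ?(ltnW jN) // (negbTE ne).
rewrite (vmatE _ jN) /par_of /= ec ifF //; apply/negP => /eqP e2.
by move: hb; rewrite /contains e2 ltnn !andbF.
Qed.

Lemma hvec_step k s : through k s -> hvec x sg k s *m (Amat x k)^T = hvec x sg k.+1 s.
Proof. by rewrite /contains => /andP[_ /andP[h _]]; rewrite /hvec -mulmxA img_step. Qed.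

Lemma par_image_hmx k : (k < N)%N -> par_image par_of sg k = hmx k *m (Amat x k)^T.
Proof.
move=> kN; apply/row_matrixP => c.
rewrite row_mul rowK hvec_step ?has_lab ?(ltnW kN) //.
apply/rowP => a; rewrite mxE mxE; case: ifP => e; last first.
  by rewrite (vmatE _ kN) /par_of /= e.
rewrite -[RHS](congr1 (fun w : 'rV_(dn k.+1) => w 0 a) (mulmxKV (hmx_unit kN) _)) [RHS]mxE.
apply: eq_bigr => a' _; rewrite par_basis_hmx // (vmatE _ kN) /par_of /= e //.
Qed.

(** Cramer's rule, solving [par_image = hmx k *m (Amat x k)^T] for A_(k+1), in the numerator and
    denominator form of [rational_image_dependent]. *)
Lemma par_recover k a c (kN : (k < N)%N) :
  \det (par_basis par_of sg k) != 0 /\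
  x (var kN a c) * \det (par_basis par_of sg k) =
    (\adj (par_basis par_of sg k) *m par_image par_of sg k) c a.
Proof.
rewrite par_basis_hmx ?(ltnW kN) // par_image_hmx // mulmxA mul_adj_mx mul_scalar_mx.
split; first by have := hmx_unit (ltnW kN); rewrite unitmxE unitfE.
by rewrite mxE mxE Amat_vmat (vmatE _ kN) mulrC.
Qed.

End Point.

Lemma in_vars_mul (J : {set 'I_(nv d)}) (p q : {mpoly CC[nv d]}) :
  in_vars J p -> in_vars J q -> in_vars J (p * q).
Proof.
move=> hp hq mo /msuppM_le/allpairsP[[m1 m2] /= [h1 h2 ->]] i iJ.
by rewrite mnmDE (hp m1) // (hq m2).
Qed.

Lemma alg_indep_leq (J : {set 'I_(nv d)}) :
  alg_indep (Defs.orbit m) J -> (#|J| <= #|free_coords m|)%N.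
Proof.
move=> iJ; rewrite leqNgt; apply/negP => lt.
set D := #|free_coords m| in lt.
(* One unknown for each free coordinate, and 0 at the others, in agreement with [par_of_bad]. *)
pose thX (v : Var d) : {mpoly CC[D]} :=
  if [pick b : 'I_D | enum_val b == enum_rank v] is Some b then 'X_b else 0.
pose f (sg : strT -> 'I_(bnd d)) (i : 'I_(nv d)) : {mpoly CC[D]} :=
  (\adj (par_basis thX sg (tag (enum_val i))) *m par_image thX sg (tag (enum_val i)))
    (tagged (enum_val i)).2 (tagged (enum_val i)).1.
pose g (sg : strT -> 'I_(bnd d)) (i : 'I_(nv d)) : {mpoly CC[D]} :=
  \det (par_basis thX sg (tag (enum_val i))).
have [p p0 pP] := fin_all_exists2 (fun sg : {ffun strT -> 'I_(bnd d)} => rational_image_dependent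
  (f sg) (g sg) lt).
(* Each point of the orbit has some adapted [sg], whose factor vanishes there. *)
suff : \prod_sg p sg = 0 by move/eqP; apply/negP/prodf_neq0.
apply: iJ.
  apply: (big_ind (in_vars J)); first by move=> mo; rewrite msupp1 inE => /eqP -> i _;
    rewrite mnm0E.
    exact: in_vars_mul.
  by move=> sg _ mo mop i iJ; apply: (pP sg).1 iJ.
move=> x xO; have [sg sgP] := exists_adapted km xO.
rewrite rmorph_prod /= (bigD1 sg) //=.
pose t (b : 'I_D) := par_of x sg (enum_val (enum_val b)).
rewrite ((pP sg).2 _ t) ?mul0r // => i.
have thE v : (thX v).@[t] = par_of x sg v.
  rewrite /thX; case: pickP => [b /eqP e|none]; first by rewrite mevalXU /t e enum_rankK.
  rewrite meval0 (par_of_bad xO sgP) //; apply: contraT => nb.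
  have vf : enum_rank v \in free_coords m by rewrite inE enum_rankK.
  by have := none (enum_rank_in vf (enum_rank v)); rewrite enum_rankK_in // eqxx.
rewrite /coords /f /g; have [k [hk [a [c ->]]]] := varE (enum_val i).
have := par_recover xO sgP a c hk.
rewrite -(par_basis_map (phi := meval t) sg (ltnW hk) thE) -(par_image_map (phi := meval t) sg hk
  thE).
by rewrite -map_mx_adj -map_mxM !det_map_mx [_ c a]mxE.
Qed.

Lemma dimS_orbit : dimS (Defs.orbit m) = #|free_coords m|.
Proof.
have pboolP (Q : Prop) : reflect Q (pbool Q).
  by rewrite /pbool; case: ClassicalEpsilon.excluded_middle_informative => h; constructor.
apply/eqP; rewrite eqn_leq; apply/andP; split.
  by apply/bigmax_leqP => J /pboolP; apply: alg_indep_leq.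
apply: (leq_bigmax_cond (F := fun J : {set 'I_(nv d)} => #|J|)).
exact/pboolP/alg_indep_free_coords.
Qed.

End Parametrization.

(** * Identities for the series P *)

Section QSums.
Variables (R : comNzRingType) (q : R) (P : nat -> R).
Hypothesis P0 : P 0 = 1.
Hypothesis PS : forall n, P n = (1 - q ^+ n.+1) * P n.+1.

(* P_(n - k), read as 0 when k > n *)
Definition Psub n k : R := if (k <= n)%N then P (n - k) else 0.

Lemma PsubSS n k : Psub n.+1 k.+1 = Psub n k.
Proof. by rewrite /Psub ltnS subSS. Qed.

Lemma PsubnS n k : Psub n k.+1 = (1 - q ^+ (n - k)) * Psub n k.
Proof.
rewrite /Psub; case: (ltngtP k n) => [lt|gt|->].
- by rewrite PS -subSn // subSS.
- by rewrite mulr0.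
- by rewrite subnn expr0 subrr mul0r.
Qed.

Lemma PsubSn n k : (k <= n)%N -> Psub n k = (1 - q ^+ (n.+1 - k)) * Psub n.+1 k.
Proof. by move=> le; rewrite -PsubnS PsubSS. Qed.

Fixpoint qfac n : R := if n is n'.+1 then qfac n' * (1 - q ^+ n) else 1.

Lemma qfacP n : qfac n * P n = 1.
Proof. by elim: n => [|n IH] /=; rewrite ?P0 ?mul1r // -mulrA -PS. Qed.

(** The factor divides [qfac n.+1], which [qfacP] makes invertible; this allows cancellation in an
    arbitrary commutative ring. *)
Lemma one_subq_reg n (x y : R) : (1 - q ^+ n.+1) * x = (1 - q ^+ n.+1) * y -> x = y.
Proof.
move=> e; rewrite -[x]mul1r -[y]mul1r -(qfacP n.+1) /=.
have aux z : qfac n * (1 - q ^+ n.+1) * P n.+1 * z = qfac n * P n.+1 * ((1 - q ^+ n.+1) * z) by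
  ring.
by rewrite !aux e.
Qed.

Lemma durfee a E :
  \sum_(b < a.+1) Psub a b * P b * Psub E b * q ^+ ((a - b) * (E - b)) = P a * P E.
Proof.
elim: a => [|a IH].
  by rewrite big_ord1 /Psub !leq0n !subn0 mul0n expr0 P0 !mulr1 mul1r.
(* 1 - q^(a+1) = (1 - q^(a+1-b)) + q^(a+1-b) (1 - q^b) splits the sum in two; with b shifted by one
   in the second, the terms recombine into those for a. *)
apply: (@one_subq_reg a); rewrite mulrA -PS -{}IH mulr_sumr.
pose F1 b := (1 - q ^+ (a.+1 - b)) * Psub a.+1 b * P b * Psub E b * q ^+ ((a.+1 - b) * (E - b)).
pose F2 b := q ^+ (a.+1 - b) * Psub a.+1 b * ((1 - q ^+ b) * P b) * Psub E b * q ^+ ((a.+1 - b) *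
  (E - b)).
transitivity (\sum_(b < a.+2) F1 b + \sum_(b < a.+2) F2 b).
  rewrite -big_split /=; apply: eq_bigr => b _; rewrite /F1 /F2.
  have -> : q ^+ a.+1 = q ^+ (a.+1 - b) * q ^+ b by rewrite -exprD subnK // -ltnS.
  by ring.
rewrite big_ord_recr /= {2}/F1 subnn expr0 subrr !mul0r addr0.
rewrite [X in _ + X]big_ord_recl /= {1}/F2 expr0 subrr mul0r mulr0 !mul0r add0r.
rewrite -big_split /=; apply: eq_bigr => b _.
have lb : (b <= a)%N by rewrite -ltnS.
rewrite /F1 /F2 /bump /= add1n PsubSS -PS PsubnS subSS.
rewrite -(PsubSn lb) /Psub lb; case: leqP => hb; last by rewrite !(mulr0, mul0r, addr0).
rewrite subSn // mulSn exprD.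
case: (ltngtP b E) hb => // [lt|eq] _; last first.
  by rewrite eq subnn expr0 !muln0 !expr0; ring.
have -> : ((a - b) * (E - b) = (a - b) + (a - b) * (E - b.+1))%N by rewrite -mulnS -subSn // subSS.
rewrite exprD; ring.
Qed.

(** By Euler's expansions, the coefficient of z^n in (z; q)_oo times its inverse. In the proof, 1 -
    q^(n+1) is split as (1 - q^s) + q^s (1 - q^(n+1-s)), and the shifted halves cancel term by
    term. *)
Lemma alternating_sum n :
  \sum_(s < n.+1) (-1) ^+ s * q ^+ 'C(s, 2) * P s * P (n - s) = (n == 0%N)%:R.
Proof.
case: n => [|n]; first by rewrite big_ord1 /= !expr0 P0 !mulr1.
apply: (@one_subq_reg n); rewrite mulr0 mulr_sumr.
pose F1 s := (-1) ^+ s * q ^+ 'C(s, 2) * ((1 - q ^+ s) * P s) * P (n.+1 - s).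
pose F2 s := (-1) ^+ s * q ^+ 'C(s, 2) * q ^+ s * P s * ((1 - q ^+ (n.+1 - s)) * P (n.+1 - s)).
transitivity (\sum_(s < n.+2) F1 s + \sum_(s < n.+2) F2 s).
  rewrite -big_split /=; apply: eq_bigr => s _; rewrite /F1 /F2.
  have -> : q ^+ n.+1 = q ^+ (n.+1 - s) * q ^+ s by rewrite -exprD subnK // -ltnS.
  by ring.
rewrite [X in _ + X]big_ord_recr /= {2}/F2 subnn expr0 subrr mul0r mulr0 addr0.
rewrite big_ord_recl /= {1}/F1 expr0 subrr mul0r mulr0 mul0r add0r.
rewrite -big_split /= big1 // => s _; have ls : (s <= n)%N by rewrite -ltnS.
rewrite /F1 /F2 /bump /= add1n subSS -PS subSn // -PS binS bin1 exprD exprS.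
by ring.
Qed.

(** Of a strings of a row at some vertex, b go on to the next, where e dimensions are left: a - b
    strings end, and P_(e-b) stands for what later rows will contribute there. *)
Definition row_step (a e : nat) (F : nat -> R) : R :=
  \sum_(b < a.+1) Psub a b * Psub e b * q ^+ ((a - b) * (e - b)) * F b.

Fixpoint row_sum (F : nat -> R) (a : nat) (ds : seq nat) : R :=
  if ds is e :: ds' then row_step a e (fun b => row_sum F b ds') else F a.

(** Summing out a row restores the product of P's of the dimensions available before it, so all rows
    can be treated alike. *)
Lemma row_sum_total a ds : row_sum P a ds = P a * \prod_(e <- ds) P e.
Proof.
elim: ds a => [|e ds IH] a /=; first by rewrite big_nil mulr1.
rewrite /row_step big_cons mulrA -durfee mulr_suml; apply: eq_bigr => b _.
by rewrite IH; ring.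
Qed.

(** [durfee] with a, e and b translated by c; if c exceeds a or e, both sides are 0. *)
Lemma durfee_shift a e c :
  \sum_(b < a.+1) Psub a b * Psub e b * q ^+ ((a - b) * (e - b)) * Psub b c = Psub a c * Psub e c.
Proof.
have [lea|lta] := leqP c a; last first.
  rewrite [Psub a c]/Psub leqNgt lta /= mul0r big1 // => b _.
  rewrite [Psub b c]/Psub leqNgt (leq_trans _ lta) ?mulr0 //; exact: ltn_ord b.
have [lee|lte] := leqP c e; last first.
  rewrite [Psub e c]/Psub leqNgt lte /= mulr0 big1 // => b _.
  rewrite [Psub b c]/Psub; case: leqP => h; last by rewrite mulr0.
  by rewrite [Psub e b]/Psub leqNgt (leq_trans lte h) /= !(mulr0, mul0r).
have [a' ->] : exists a', a = (c + a')%N by exists (a - c)%N; lia.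
have [e' ->] : exists e', e = (c + e')%N by exists (e - c)%N; lia.
have -> : Psub (c + a') c * Psub (c + e') c = P a' * P e'.
  by rewrite /Psub !leq_addr !addKn.
rewrite -durfee -addnS big_split_ord /= [X in X + _]big1 ?add0r => [|b _]; last first.
  by rewrite [Psub b c]/Psub leqNgt ltn_ord /= mulr0.
apply: eq_bigr => b _.
by rewrite /Psub !leq_add2l !subnDl leq_addr addKn; ring.
Qed.

(** [alternating_sum] expands the indicator of a = r into terms P_(a-r-s), and [durfee_shift]
    carries each of them through the row. The range B may be any bound above a, so it stays fixed
    when a drops to b. *)
Lemma row_sum_end B r a ds : (a < B)%N ->
  row_sum (fun b => (b == r)%:R * P b) a ds =
  P r * \sum_(s < B) (-1) ^+ s * q ^+ 'C(s, 2) * P s * \prod_(e <- a :: ds) Psub e (r + s).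
Proof.
elim: ds a => [|e ds IH] a ltB /=.
  transitivity (P r * \sum_(s < B) (-1) ^+ s * q ^+ 'C(s, 2) * P s * Psub a (r + s)); last first.
    by congr (_ * _); apply: eq_bigr => s _; rewrite big_seq1.
  have [lt|le] := ltnP a r.
    rewrite (ltn_eqF lt) mul0r big1 ?mulr0 // => s _.
    by rewrite /Psub leqNgt (leq_trans lt (leq_addr _ _)) mulr0.
  transitivity ((a - r == 0)%N%:R * P r).
    rewrite subn_eq0 eqn_leq le andbT; have [le2|_] := leqP a r; last by rewrite !mul0r.
    by rewrite (@anti_leq a r) ?le ?le2.
  rewrite mulrC; congr (_ * _).
  rewrite -alternating_sum (big_ord_widen B (fun s => (-1) ^+ s * q ^+ 'C(s, 2) * P s * P (a - r
    - s))); last by lia.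
  rewrite [in RHS](bigID (fun s : 'I_B => (s < (a - r).+1)%N)) /=.
  rewrite [X in _ + X]big1 ?addr0 => [|s]; last by rewrite /Psub => h; rewrite ifF ?mulr0 //; lia.
  by apply: eq_bigr => s h; rewrite /Psub subnDA ifT //; lia.
rewrite /row_step /=.
under eq_bigr => b _ do rewrite IH ?(leq_trans (ltn_ord b)) //.
under eq_bigr => b _ do rewrite mulrCA mulr_sumr mulr_sumr.
rewrite exchange_big mulr_sumr /=; apply: eq_bigr => s _.
rewrite -mulr_sumr; congr (_ * _).
rewrite !big_cons mulrA -durfee_shift !mulr_suml mulr_sumr; apply: eq_bigr => b _.
by rewrite big_cons; ring.
Qed.

End QSums.

(** * Summation over Kostant partitions *)

Section FfunCons.
Variable T : finType.

Definition fcons n (x : T) (f : {ffun 'I_n -> T}) : {ffun 'I_n.+1 -> T} :=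
  [ffun k => oapp f x (unlift ord0 k)].

Lemma fcons0 n x (f : {ffun 'I_n -> T}) : fcons x f ord0 = x.
Proof. by rewrite ffunE unlift_none. Qed.

Lemma fconsS n x (f : {ffun 'I_n -> T}) k : fcons x f (lift ord0 k) = f k.
Proof. by rewrite ffunE liftK. Qed.

Lemma big_fcons (R : nmodType) n (F : {ffun 'I_n.+1 -> T} -> R) :
  \sum_f F f = \sum_x \sum_f F (fcons x f).
Proof.
rewrite pair_big /= (reindex (fun p : T * {ffun 'I_n -> T} => fcons p.1 p.2)) //.
exists (fun f : {ffun 'I_n.+1 -> T} => (f ord0, [ffun k : 'I_n => f (lift ord0 k)])) => [[x f]|f]
  _ /=.
  by rewrite fcons0; congr (_, _); apply/ffunP => k; rewrite ffunE fconsS.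
apply/ffunP => k; case: (unliftP ord0 k) => [j|] ->; last by rewrite fcons0.
by rewrite fconsS ffunE.
Qed.
End FfunCons.

Section RowSum.
Variables (R : comNzRingType) (q : R) (P : nat -> R).
Hypothesis P0 : P 0 = 1.
Variables (B : nat) (chi : nat -> R).

(** With [f l] the number of strings of a row ending at l, the number of those that reach k. *)
Definition tail n (f : {ffun 'I_n -> 'I_B}) (k : nat) : nat :=
  (\sum_(l < n | k <= l) f l)%N.

Lemma tail_fconsS n x (f : {ffun 'I_n -> 'I_B}) k : tail (fcons x f) k.+1 = tail f k.
Proof.
rewrite /tail big_mkcond big_ord_recl /= add0n [RHS]big_mkcond.
by apply: eq_bigr => l _; rewrite fconsS.
Qed.

Lemma tail_fcons0 n x (f : {ffun 'I_n -> 'I_B}) : tail (fcons x f) 0 = (x + tail f 0)%N.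
Proof.
rewrite /tail big_ord_recl fcons0; congr (_ + _)%N.
by apply: eq_bigr => l _; rewrite fconsS.
Qed.

(** Equality at i, because no later row meets the vertex i; only an inequality beyond it. *)
Definition row_ok n i (a : nat) (e : nat -> nat) (f : {ffun 'I_n.+1 -> 'I_B}) : bool :=
  [&& [forall k : 'I_n.+1, (k < i)%N ==> (f k == 0 :> nat)], tail f i == a
    & [forall k : 'I_n, (i <= k)%N ==> (tail f k.+1 <= e k.+1)%N]].

(** The exponent also has a term for the last vertex k = n; it disappears once [e n.+1] is 0. *)
Definition row_weight n (e : nat -> nat) (f : {ffun 'I_n.+1 -> 'I_B}) : R :=
  q ^+ (\sum_(k < n.+1) f k * (e k.+1 - tail f k.+1)) * (\prod_(k < n.+1) P (f k))
  * \prod_(k < n) P (e k.+1 - tail f k.+1).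

Lemma row_okS n i a e x (f : {ffun 'I_n.+1 -> 'I_B}) :
  row_ok i.+1 a e (fcons x f) = (x == 0 :> nat) && row_ok i a (fun k => e k.+1) f.
Proof.
rewrite /row_ok tail_fconsS [RHS]andbA; congr [&& _, _ & _].
  apply/forallP/andP => [h|[/eqP h1 /forallP h2] k].
    split; first by have := h ord0; rewrite fcons0.
    by apply/forallP => k; have := h (lift ord0 k); rewrite fconsS.
  case: (unliftP ord0 k) => [j|] ->; first by rewrite fconsS; apply: h2.
  by rewrite fcons0 h1.
apply/forallP/forallP => h k.
  by have := h (lift ord0 k); rewrite tail_fconsS.
case: (unliftP ord0 k) => [j|] -> //.
by rewrite tail_fconsS; apply: h.
Qed.

Lemma row_ok0 n a e x (f : {ffun 'I_n.+1 -> 'I_B}) :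
  row_ok 0 a e (fcons x f) =
  [&& (x <= a)%N, (a - x <= e 1%N)%N & row_ok 0 (a - x)%N (fun k => e k.+1) f].
Proof.
have triv m (g : {ffun 'I_m.+1 -> 'I_B}) : [forall k : 'I_m.+1, (k < 0)%N ==> (g k == 0 :> nat)].
  by apply/forallP.
rewrite /row_ok !triv /= tail_fcons0.
apply/andP/and4P => [[/eqP h1 /forallP h2]|[h1 h2 /eqP h3 /forallP h4]].
  have e1 : (a - x = tail f 0)%N by lia.
  split; [lia| | by apply/eqP | ].
    by have := h2 ord0; rewrite tail_fconsS e1.
  by apply/forallP => k; have := h2 (lift ord0 k); rewrite tail_fconsS.
split; first by apply/eqP; lia.
apply/forallP => k; case: (unliftP ord0 k) => [j|] -> /=.
  by rewrite tail_fconsS; apply: h4.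
by rewrite tail_fconsS h3.
Qed.

Lemma row_weight_fcons n e x (f : {ffun 'I_n.+1 -> 'I_B}) :
  row_weight e (fcons x f) =
  q ^+ (x * (e 1%N - tail f 0)) * P x * P (e 1%N - tail f 0) * row_weight (fun k => e k.+1) f.
Proof.
rewrite /row_weight.
have -> : (\sum_(k < n.+2) fcons x f k * (e k.+1 - tail (fcons x f) k.+1) =
           x * (e 1 - tail f 0) + \sum_(k < n.+1) f k * (e k.+2 - tail f k.+1))%N.
  rewrite big_ord_recl fcons0 tail_fconsS; congr addn.
  by apply: eq_bigr => k _; rewrite fconsS tail_fconsS.
have -> : \prod_(k < n.+2) P (fcons x f k) = P x * \prod_(k < n.+1) P (f k).
  by rewrite big_ord_recl fcons0; congr (_ * _); apply: eq_bigr => k _; rewrite fconsS.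
have -> : \prod_(k < n.+1) P (e k.+1 - tail (fcons x f) k.+1) =
          P (e 1%N - tail f 0) * \prod_(k < n) P (e k.+2 - tail f k.+1).
  by rewrite big_ord_recl tail_fconsS; congr (_ * _); apply: eq_bigr => k _; rewrite tail_fconsS.
by rewrite exprD; ring.
Qed.

Lemma row_sumE n i a e : (i <= n)%N -> (a < B)%N -> e n.+1 = 0%N ->
  (forall k, (0 < k <= i)%N -> e k = 0%N) ->
  \sum_(f : {ffun 'I_n.+1 -> 'I_B} | row_ok i a e f) chi (f ord_max) * row_weight e f =
  row_sum q P (fun b => chi b * P b) a [seq e k | k <- iota i.+1 (n - i)].
Proof.
move=> + ltB; elim: n i a e ltB => [|n IH] i a e ltB lein en0 e0.
  have -> : i = 0%N by lia.
  rewrite big_mkcond (big_fcons (T := 'I_B)) (bigD1 (Ordinal ltB)) //= [X in _ + X]big1 ?addr0 =>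
    [|x nx].
    rewrite (bigD1 [ffun=> Ordinal ltB]) //= [X in _ + X]big1 ?addr0 => [|g]; last first.
      by case/eqP; apply/ffunP => -[].
    have -> : ord_max = ord0 :> 'I_1 by apply/val_inj.
    rewrite ifT ?fcons0 /=.
      rewrite /row_weight big_ord0 !big_ord1 en0 sub0n muln0 fcons0 /= expr0; ring.
    rewrite /row_ok; apply/and3P; split; first by apply/forallP.
      by rewrite tail_fcons0 /tail big_ord0 addn0.
    by apply/forallP => -[].
  rewrite big1 // => g _; rewrite ifF //; apply/negP => /and3P[_ + _].
  rewrite tail_fcons0 /tail big_ord0 addn0 => /eqP h.
  by case/eqP: nx; apply/val_inj.
rewrite big_mkcond (big_fcons (T := 'I_B)).
have mx x (f : {ffun 'I_n.+1 -> 'I_B}) : fcons x f ord_max = f ord_max.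
  have -> : ord_max = lift ord0 (ord_max : 'I_n.+1) by apply/val_inj.
  exact: fconsS.
case: i lein e0 => [|i] lein e0.
  transitivity (\sum_(x < B | (x <= a)%N && (a - x <= e 1%N)%N)
     q ^+ (x * (e 1%N - (a - x))) * P x * P (e 1%N - (a - x)) *
     row_sum q P (fun b => chi b * P b) (a - x)%N [seq e k | k <- iota 2 n]).
    rewrite [RHS]big_mkcond; apply: eq_bigr => x _; case: ifP => h; last first.
      by rewrite big1 // => f _; rewrite row_ok0 andbA h.
    have -> : [seq e k | k <- iota 2 n] = [seq e k.+1 | k <- iota 1 (n - 0)].
      by rewrite subn0 -(addn1 1) iotaDl -map_comp; apply: eq_map => k /=; rewrite add1n.
    rewrite -(IH 0%N (a - x)%N (fun k => e k.+1)) //; [|lia|by case].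
    rewrite mulr_sumr [RHS]big_mkcond; apply: eq_bigr => f _.
    rewrite row_ok0 andbA h /=; case: ifP => // /and3P[_ /eqP hf _].
    by rewrite row_weight_fcons hf mx; ring.
  (* [row_step] sums over the strings that continue, whereas x counts those that end: b = a - x. *)
  rewrite subn0 /= /row_step [RHS](reindex_inj rev_ord_inj) /=.
  rewrite [in RHS](eq_bigr (fun x : 'I_a.+1 => (fun x : nat => if (a - x <= e 1%N)%N then q ^+ (x
    * (e 1%N - (a - x))) * P x * P (e 1%N - (a - x)) *
     row_sum q P (fun b => chi b * P b) (a - x)%N [seq e k | k <- iota 2 n] else 0) x)); last first.
    move=> x _; rewrite subSS /Psub leq_subr subKn -1?ltnS //.
    by case: ifP => _; ring.
  rewrite (big_ord_widen B (fun x : nat => if (a - x <= e 1%N)%N then q ^+ (x * (e 1%N - (a -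
    x))) * P x * P (e 1%N - (a - x)) *
     row_sum q P (fun b => chi b * P b) (a - x)%N [seq e k | k <- iota 2 n] else 0)) //.
  by rewrite -big_mkcondr.
have B0 : (0 < B)%N by lia.
rewrite (bigD1 (Ordinal B0)) //= [X in _ + X]big1 ?addr0 => [|x nx]; last first.
  rewrite big1 // => f _; rewrite row_okS ifF //; apply/negP => /andP[/eqP h _].
  by case/eqP: nx; apply/val_inj.
have -> : [seq e k | k <- iota i.+2 (n.+1 - i.+1)] = [seq e k.+1 | k <- iota i.+1 (n - i)].
  by rewrite subSS -(addn1 i.+1) addnC iotaDl -map_comp; apply: eq_map => k /=; rewrite add1n.
rewrite -(IH i a (fun k => e k.+1)) // => [|k hk]; last by apply: e0; lia.
rewrite [RHS]big_mkcond; apply: eq_bigr => f _; rewrite row_okS /=.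
case: ifP => // _; rewrite row_weight_fcons mx e0 //= mul0n sub0n expr0 P0 !mul1r //.
Qed.
End RowSum.

Section KostantSum.
Variables (N : nat) (d : 'I_N.+1 -> nat).
Variables (R : comNzRingType) (q : R) (P : nat -> R).
Hypothesis P0 : P 0 = 1.
Hypothesis PS : forall n, P n = (1 - q ^+ n.+1) * P n.+1.

Local Notation KP := (KP d).
Local Notation row := {ffun 'I_N.+1 -> 'I_(bnd d)}.

Definition rowf (m : KP) (i : 'I_N.+1) : row := [ffun j => m (i, j)].

Definition set_row (m : KP) (i : 'I_N.+1) (f : row) : KP :=
  [ffun p => if p.1 == i then f p.2 else m p].

Lemma rowf_set_row m i f i' : rowf (set_row m i f) i' = if i' == i then f else rowf m i'.
Proof. by case: ifP => h; apply/ffunP => j; rewrite !ffunE /= h. Qed.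

(* Number of strings of rows < i containing k, for k >= i - 1. *)
Definition used (m : KP) (i k : nat) : nat :=
  (\sum_(i' < N.+1 | i' < i) tail (rowf m i') k)%N.

Definition remdim (m : KP) (i k : nat) : nat := (dn d k - used m i k)%N.

(** The vertex k is met only by the rows up to k, so the rows before i fill the vertices before i
    exactly and must merely fit at the others. *)
Definition prefix_ok (i : nat) (m : KP) : bool :=
  [&& [forall i' : 'I_N.+1, forall j : 'I_N.+1, (j < i' < i)%N ==> (mE m i' j == 0%N)],
      [forall k : 'I_N.+1, (k < i)%N ==> (dn d k == used m k.+1 k)]
    & [forall k : 'I_N.+1, (i <= k)%N ==> (used m i k <= dn d k)%N]].

Definition agree (i : nat) (m m' : KP) : bool :=
  [forall i' : 'I_N.+1, (i' < i)%N ==> (rowf m i' == rowf m' i')].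

(** [remdim m i'.+1 k.+1] is d_(k+1) - r_(i',k+1); at k = N it is 0, since [dn] is 0 beyond N. *)
Definition expo (i : nat) (m : KP) : nat :=
  (\sum_(i' < N.+1 | i' < i) \sum_(k < N.+1) mE m i' k * remdim m i'.+1 k.+1)%N.

Definition Pprefix (i : nat) (m : KP) : R :=
  \prod_(i' < N.+1 | (i' < i)%N) \prod_(k < N.+1) P (mE m i' k).

Definition kweight (m : KP) : R := q ^+ expo N.+1 m * Pprefix N.+1 m.

Lemma dn_ord (k : 'I_N.+1) : dn d k = d k.
Proof. by rewrite /dn -ltnS ltn_ord inord_val. Qed.

Lemma big_lt_recr (T : Type) (idx : T) (op : Monoid.com_law idx) (i : 'I_N.+1) (F : 'I_N.+1 -> T) :
  \big[op/idx]_(i' < N.+1 | (i' < i.+1)%N) F i' = op (\big[op/idx]_(i' < N.+1 | (i' < i)%N) F i')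
    (F i).
Proof.
rewrite (bigD1 i) //= Monoid.mulmC; congr (op _ _); apply: eq_bigl => i'.
by rewrite ltnS [in RHS]ltn_neqAle andbC.
Qed.

Lemma kostant_prefix m : kostant m = prefix_ok N.+1 m.
Proof.
have usedE (k : 'I_N.+1) : used m k.+1 k =
    (\sum_(i < N.+1) \sum_(j < N.+1 | (i <= k <= j)%N) mE m i j)%N.
  rewrite /used big_mkcond; apply: eq_bigr => i _; rewrite ltnS.
  case: leqP => h; last by rewrite big_pred0.
  by apply: eq_bigr => j _; rewrite ffunE.
rewrite /kostant /prefix_ok; congr andb.
  by apply: eq_forallb => i; apply: eq_forallb => j; rewrite ltn_ord andbT.
rewrite [X in _ = _ && X](_ : _ = true) ?andbT.
  by apply: eq_forallb => k; rewrite ltn_ord usedE dn_ord.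
by apply/forallP => k; rewrite ltnNge -ltnS ltn_ord.
Qed.

Lemma used_set_row m (i : 'I_N.+1) f i' k : (i' <= i)%N -> used (set_row m i f) i' k = used m i' k.
Proof.
move=> h; apply: eq_bigr => i'' h''; rewrite rowf_set_row ifF //.
by apply/eqP => e; move: h''; rewrite e ltnNge h.
Qed.

Lemma used_set_rowS m (i : 'I_N.+1) f k :
  used (set_row m i f) i.+1 k = (used m i k + tail f k)%N.
Proof.
rewrite {1}/used big_lt_recr /= rowf_set_row eqxx; congr addn.
exact: used_set_row.
Qed.

Lemma remdim_set_rowS m (i : 'I_N.+1) f k : remdim (set_row m i f) i.+1 k = (remdim m i k - tail
  f k)%N.
Proof. by rewrite /remdim used_set_rowS subnDA. Qed.

Lemma mE_set_row m i f i' k : mE (set_row m i f) i' k = (if i' == i then f k : nat else mE m i' k).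
Proof. by rewrite /mE ffunE /=; case: eqP. Qed.

(* The dimensions left for row i; set to 0 below i so that [row_weight] needs no range
  restriction. *)
Definition row_dims (m : KP) (i k : nat) : nat := if (i < k)%N then remdim m i k else 0%N.

Lemma prefix_ok_set_row m (i : 'I_N.+1) f :
  prefix_ok i.+1 (set_row m i f) = prefix_ok i m && row_ok i (remdim m i i) (row_dims m i) f.
Proof.
have mEf (i' : 'I_N.+1) j : (i' < i)%N -> mE (set_row m i f) i' j = mE m i' j.
  by move=> h; rewrite mE_set_row ifF //; apply/eqP => e; rewrite e ltnn in h.
apply/and3P/andP => [[/forallP h1 /forallP h2 /forallP h3]|].
  have hi := h2 i; rewrite ltnS leqnn /= used_set_rowS in hi.
  split; apply/and3P; split.
  - apply/forallP => i'; apply/forallP => j; apply/implyP => /andP[a b].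
    by have /forallP/(_ j) := h1 i'; rewrite a ltnS (ltnW b) /= mEf.
  - apply/forallP => k; apply/implyP => lt; have := h2 k.
    by rewrite ltnS (ltnW lt) /= used_set_row.
  - apply/forallP => k; apply/implyP => le; have [lt|e] := ltnP i k.
      have := h3 k; rewrite lt used_set_rowS /=; lia.
    have -> : k = i by apply/val_inj/anti_leq; rewrite le e.
    lia.
  - apply/forallP => k; apply/implyP => lt; have /forallP/(_ k) := h1 i.
    by rewrite lt ltnS leqnn /= mE_set_row eqxx.
  - by rewrite /remdim; lia.
  - apply/forallP => k; apply/implyP => le; have lt : (k.+1 < N.+1)%N by rewrite ltnS ltn_ord.
    have := h3 (Ordinal lt); rewrite /row_dims ltnS le used_set_rowS /= /remdim; lia.
case=> /and3P[/forallP h1 /forallP h2 /forallP h3] /and3P[/forallP g1 g2 /forallP g3].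
have hi := h3 i; rewrite leqnn /= in hi.
split.
- apply/forallP => i'; apply/forallP => j; apply/implyP => /andP[a b].
  have [lt|e] := ltnP i' i; first by rewrite mEf //; have /forallP/(_ j) := h1 i'; rewrite a lt.
  have -> : i' = i by apply/val_inj/anti_leq; rewrite e -ltnS b.
  rewrite mE_set_row eqxx; have := g1 j; rewrite (leq_trans a) //.
- apply/forallP => k; apply/implyP; rewrite ltnS leq_eqVlt => /orP[/eqP e|lt]; last first.
    by rewrite used_set_row //; have := h2 k; rewrite lt.
  have -> : k = i by apply/val_inj.
  rewrite used_set_rowS; move: g2; rewrite /remdim; lia.
- apply/forallP => -[[|k] hk] //=; apply/implyP; rewrite ltnS => le.
  have := g3 (Ordinal (hk : (k < N)%N)); rewrite /row_dims /= ltnS le used_set_rowS /remdim /=.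
  have := h3 (Ordinal hk); rewrite /= (leq_trans le) //=; lia.
Qed.

Lemma agree_set_row m0 (i : 'I_N.+1) f m :
  agree i.+1 m (set_row m0 i f) = agree i m m0 && (rowf m i == f).
Proof.
apply/forallP/andP => [h|[/forallP h1 /eqP h2] i'].
  split; last by have := h i; rewrite ltnS leqnn /= rowf_set_row eqxx.
  apply/forallP => i'; apply/implyP => lt; have := h i';
    rewrite ltnS (ltnW lt) /= rowf_set_row ifF //.
  by apply/eqP => e; rewrite e ltnn in lt.
apply/implyP; rewrite ltnS rowf_set_row leq_eqVlt => /orP[/eqP e|lt].
  by have -> : i' = i by [apply/val_inj]; rewrite eqxx h2.
rewrite ifF; first by have := h1 i'; rewrite lt.
by apply/eqP => e; rewrite e ltnn in lt.
Qed.

(** The closed form of the sum over all completions of the rows before i: every dimension still free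
    contributes its P. Inadmissible rows have no completion, hence the 0. *)
Definition prefix_value (i : nat) (m : KP) : R :=
  if prefix_ok i m then
    q ^+ expo i m * Pprefix i m * \prod_(k < N.+1 | (i <= k)%N) P (remdim m i k)
  else 0.

Lemma expo_set_rowS m (i : 'I_N.+1) f :
  expo i.+1 (set_row m i f) = (expo i m + \sum_(k < N.+1) f k * (remdim m i k.+1 - tail f k.+1))%N.
Proof.
rewrite /expo big_lt_recr /=; congr addn; last first.
  by apply: eq_bigr => k _; rewrite mE_set_row eqxx remdim_set_rowS.
apply: eq_bigr => i' lt; apply: eq_bigr => k _.
rewrite mE_set_row ifF; last by apply/eqP => e; rewrite e ltnn in lt.
by rewrite /remdim used_set_row.
Qed.

Lemma Pprefix_set_rowS m (i : 'I_N.+1) f :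
  Pprefix i.+1 (set_row m i f) = Pprefix i m * \prod_(k < N.+1) P (f k).
Proof.
rewrite /Pprefix big_lt_recr /=; congr (_ * _); last first.
  by apply: eq_bigr => k _; rewrite mE_set_row eqxx.
apply: eq_bigr => i' lt; apply: eq_bigr => k _.
by rewrite mE_set_row ifF //; apply/eqP => e; rewrite e ltnn in lt.
Qed.

(** [chi] is constantly 1 for a row summed freely, and the indicator of r for row 0, whose last
    entry is m_0N. *)
Lemma sum_prefix_value (chi : nat -> R) m (i : 'I_N.+1) :
  \sum_(f : row) chi (f ord_max) * prefix_value i.+1 (set_row m i f) =
  if prefix_ok i m then
    q ^+ expo i m * Pprefix i m *
      row_sum q P (fun b => chi b * P b) (remdim m i i) [seq remdim m i k | k <- iota i.+1 (N - i)]
  else 0.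
Proof.
case: ifP => h; last first.
  by apply: big1 => f _; rewrite /prefix_value prefix_ok_set_row h mulr0.
have -> : [seq remdim m i k | k <- iota i.+1 (N - i)] = [seq row_dims m i k | k <- iota i.+1 (N -
  i)].
  by apply/eq_in_map => k; rewrite mem_iota /row_dims => /andP[-> _].
rewrite -(@row_sumE _ _ _ P0 (bnd d) chi N i) ?(leq_ltn_trans (leq_subr _ _) (dn_lt_bnd d _)) //;
  first last.
- by move=> k /andP[_ le]; rewrite /row_dims ltnNge le.
- by rewrite /row_dims /remdim /dn ltnn; case: ifP.
- by rewrite -ltnS.
rewrite [in RHS]big_mkcond mulr_sumr; apply: eq_bigr => f _.
rewrite /prefix_value prefix_ok_set_row h /=; case: ifP => [ok|]; last by rewrite !mulr0.
rewrite expo_set_rowS Pprefix_set_rowS exprD /row_weight.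
have -> : (\sum_(k < N.+1) f k * (remdim m i k.+1 - tail f k.+1) =
           \sum_(k < N.+1) f k * (row_dims m i k.+1 - tail f k.+1))%N.
  apply: eq_bigr => k _; rewrite /row_dims ltnS; case: leqP => // lt.
  by have /and3P[/forallP/(_ k) + _ _] := ok; rewrite lt => /eqP ->.
have -> : \prod_(k < N.+1 | (i < k)%N) P (remdim (set_row m i f) i.+1 k) =
          \prod_(k < N) P (row_dims m i k.+1 - tail f k.+1).
  rewrite big_mkcond big_ord_recl /= mul1r; apply: eq_bigr => k _.
  rewrite /bump /= add1n remdim_set_rowS /row_dims; case: ifP => // _.
by ring.
Qed.

(** By descending i: the last rows are summed out first, each by [row_sum_total]. *)
Lemma sum_agree m0 i : (i <= N.+1)%N ->
  \sum_(m : KP | kostant m && agree i m m0) kweight m = prefix_value i m0.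
Proof.
have [n] := ubnP (N.+1 - i); elim: n i m0 => // n IH i m0 ltn le.
have [lt|ge] := ltnP i N.+1; last first.
  have -> : i = N.+1 by apply/anti_leq; rewrite le.
  rewrite (eq_bigl (fun m => (m == m0) && prefix_ok N.+1 m0)); last first.
    move=> m; rewrite kostant_prefix andbC; apply/andP/andP => [[/forallP h k]|[/eqP -> h]].
      have e : m = m0.
        apply/ffunP => -[i1 j1]; have := h i1; rewrite ltn_ord => /eqP/ffunP/(_ j1).
        by rewrite !ffunE.
      by rewrite -e eqxx.
    by split=> //; apply/forallP => i1; rewrite eqxx implybT.
  rewrite /prefix_value; case: ifP => _; last by rewrite big_pred0 // => m; rewrite andbF.
  rewrite (eq_bigl (pred1 m0)) => [|m]; last by rewrite andbT.
  rewrite big_pred1_eq big_pred0 ?mulr1 // => k.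
  by rewrite leqNgt ltn_ord.
pose io := Ordinal lt.
transitivity (\sum_(f : row) 1 * prefix_value i.+1 (set_row m0 io f)).
  rewrite (partition_big (fun m => rowf m io) predT) //=; apply: eq_bigr => f _.
  rewrite mul1r -IH //; last by lia.
  by apply: eq_bigl => m; rewrite -[i]/(val io) agree_set_row andbA.
rewrite (sum_prefix_value (fun=> 1) m0 io) /prefix_value /=; case: ifP => // _.
congr (_ * _); transitivity (row_sum q P P (remdim m0 i i) [seq remdim m0 i k | k <- iota i.+1 (N
  - i)]).
  elim: [seq _ | _ <- _] (remdim m0 i i) => [|e ds IHd] a /=; first by rewrite mul1r.
  by apply: eq_bigr => b _; rewrite IHd.
rewrite (row_sum_total P0 PS) big_map.
transitivity (\prod_(k <- iota i (N - i).+1) P (remdim m0 i k)); first by rewrite /= big_cons.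
rewrite -(big_mkord (fun k => (i <= k)%N) (fun k => P (remdim m0 i k))).
rewrite (big_cat_nat (n := i)) //= [X in _ = X * _]big_nat_cond [X in _ = X * _]big_pred0 ?mul1r.
  rewrite [in RHS]big_nat_cond [in RHS](eq_bigl (fun k => (i <= k < N.+1)%N && true))
    -?big_nat_cond.
    by rewrite /index_iota subSn.
  by move=> k; rewrite andbT; case: (i <= k)%N; rewrite ?andbF ?andbT.
by move=> k; apply/negP => /andP[/andP[_ a] b]; rewrite ltnNge b in a.
Qed.

Lemma kostant_sum r :
  \sum_(m : KP | kostant m && (mE m ord0 ord_max == r)) kweight m =
  row_sum q P (fun b => (b == r)%:R * P b) (dn d 0) [seq dn d k | k <- iota 1 N].
Proof.
(* An arbitrary base: no row precedes row 0, and row 0 is then overwritten by f. *)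
pose m0 : KP := [ffun=> ord0].
have used0 k : used m0 0 k = 0%N by rewrite /used big_pred0.
transitivity (\sum_(f : row) (f ord_max == r :> nat)%:R * prefix_value 1 (set_row m0 ord0 f)).
  rewrite (partition_big (fun m => rowf m ord0) predT) //=; apply: eq_bigr => f _.
  rewrite -sum_agree //; case: eqP => e.
    rewrite mul1r; apply: eq_bigl => m; rewrite -[1%N]/(val (@ord0 N)).+1 agree_set_row.
    have -> : agree (@ord0 N) m m0 by apply/forallP.
    rewrite andTb -andbA; congr andb; case: (rowf m ord0 =P f) => [h|]; last by rewrite andbF.
    by rewrite andbT -e -h ffunE /mE eqxx.
  rewrite mul0r big_pred0 // => m; apply/negP => /andP[/andP[_ /eqP h] /eqP h2].
  by case: e; rewrite -h2 ffunE -h.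
rewrite (sum_prefix_value (fun b => (b == r)%:R) m0 ord0) ifT; last first.
  apply/and3P; split; first by apply/forallP => i; apply/forallP => j; rewrite ltn0 andbF.
    by apply/forallP.
  by apply/forallP => k; rewrite used0.
rewrite /expo /Pprefix !big_pred0 // expr0 !mul1r /remdim used0 subn0 subn0; congr row_sum.
by apply: eq_map => k; rewrite used0 subn0.
Qed.

End KostantSum.

(** * The codimension of an orbit *)

Section Codimension.
Local Open Scope nat_scope.
Variables (N : nat) (d : 'I_N.+1 -> nat) (m : KP d).
Hypothesis km : kostant m.
Local Notation dn := (dn d).
Local Notation strT := ('I_N.+1 * 'I_N.+1 * 'I_(bnd d))%type.
Local Notation lab := (@lab N d m _).
Local Notation through := (contains m).

Lemma codim_bad : codim (Defs.orbit m) = #|bad m|.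
Proof.
rewrite /codim (dimS_orbit km).
have -> : nv d - #|free_coords m| = #|~: free_coords m| by rewrite [RHS]cardsCs setCK card_ord.
rewrite -(card_imset (~: free_coords m) enum_val_inj); apply: eq_card => v.
rewrite [RHS]unfold_in; apply/imsetP/idP => [[i + ->]|bv].
  by rewrite !inE negbK.
by exists (enum_rank v); rewrite ?enum_rankK // !inE enum_rankK negbK.
Qed.

(** The other strings through k + 1 start at i or before, and are those used by the rows up to i. *)
Lemma card_after i k : i <= k -> k < N ->
  #|[pred t | through k.+1 t && (i < st t)]| = remdim m i.+1 k.+1.
Proof.
move=> lik kN; rewrite /remdim.
have -> : used m i.+1 k.+1 = #|[pred t | through k.+1 t && (st t <= i)]|.
  transitivity #|[pred s : strT | (s.2 < m s.1) && ((s.1.1 <= i) && (k < s.1.2))]|.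
    rewrite (card_str m (fun i0 j0 => (i0 <= i) && (k < j0))) /used big_mkcond.
    apply: eq_bigr => i' _; rewrite ltnS; case: leqP => h /=; last by rewrite big_pred0.
    by apply: eq_bigr => j _; rewrite ffunE.
  apply: eq_card => s; rewrite !inE /contains /st /en; case: (_ < _) => //=.
  by apply/idP/idP; lia.
rewrite -(card_contains km kN) -(cardID [pred t | st t <= i] (through k.+1)).
rewrite [X in _ = X + _ - _](@eq_card _ _ [pred t | through k.+1 t && (st t <= i)]); last first.
  by move=> t; rewrite !inE.
by rewrite addKn; apply: eq_card => t; rewrite !inE -ltnNge andbC.
Qed.

Lemma big_ending k (F : nat -> nat) : k <= N ->
  \sum_(s | through k s && (en s == k)) F (st s) = \sum_(i < N.+1) mE m i (inord k) * F i.
Proof.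
move=> kN.
rewrite (eq_bigl (fun s : strT => ((s.2 < m s.1) && ((s.1.1 <= k <= s.1.2) && (s.1.2 == inord
  k))))); last first.
  move=> s; rewrite /contains /st /en -andbA; congr [&& _, _ & _].
  by rewrite -val_eqE /= inordK.
rewrite -(pair_big_dep xpredT (fun p (c : 'I_(bnd d)) => (c < m p) && ((p.1 <= k <= p.2) && (p.2
  == inord k))) (fun p _ => F p.1)) /=.
pose G i j := \sum_(c < bnd d | (c < m (i, j)) && ((i <= k <= j) && (j == inord k))) F i.
rewrite (eq_bigr (fun p => G p.1 p.2)) => [|[i j] _] //; rewrite -(pair_bigA _ G) /= /G.
apply: eq_bigr => i _; rewrite (bigD1 (inord k)) //= [X in _ + X]big1 ?addn0 => [|j /negbTE ne];
  last first.
  by rewrite big_pred0 // => c; rewrite ne !andbF.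
rewrite inordK ?ltnS // leqnn eqxx !andbT; case: (leqP i k) => h.
  rewrite (eq_bigl (fun c : 'I_(bnd d) => c < m (i, inord k))) => [|c]; last by rewrite andbT.
  by rewrite -(big_ord_widen _ (fun=> F i) (ltnW (ltn_ord _))) sum_nat_const card_ord.
rewrite big_pred0 => [|c]; last by rewrite andbF.
have /andP[/forallP/(_ i)/forallP/(_ (inord k)) + _] := km.
by rewrite inordK ?ltnS // h => /eqP ->.
Qed.

Lemma codim_orbit : codim (Defs.orbit m) = expo N.+1 m.
Proof.
rewrite codim_bad -sum1_card.
transitivity (\sum_(k < N) \sum_(p : 'I_(dn k.+1) * 'I_(dn k) | bad m (Tagged (fun k : 'I_N =>
  ('I_(dn k.+1) * 'I_(dn k))%type) p)) 1).
  by rewrite sig_big_dep; apply: eq_bigl => v; rewrite /= taggedK.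
transitivity (\sum_(k < N) \sum_(i < N.+1) mE m i (inord k) * remdim m i.+1 k.+1).
  apply: eq_bigr => k _; have kN := ltn_ord k.
  rewrite -(big_ending (fun i => remdim m i.+1 k.+1) (ltnW kN)).
  transitivity (\sum_(c < dn k) \sum_(a < dn k.+1 | (en (lab c) == k) && (st (lab c) < st (lab
    a))) 1).
    by rewrite (exchange_big_dep xpredT) //= pair_big_dep.
  transitivity (\sum_(c < dn k) \sum_(t | through k.+1 t) (if (en (lab c) == k) && (st (lab c) <
    st t) then 1 else 0)).
    apply: eq_bigr => c _; rewrite big_mkcond /=.
    by rewrite (big_lab km _ (fun t => if (en (lab c) == k) && (st (lab c) < st t) then 1 else 0)).
  rewrite (big_lab km _ (fun s => \sum_(t | through k.+1 t) (if (en s == k) && (st s < st t) then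
    1 else 0))) ?(ltnW kN) //.
  rewrite [RHS]big_mkcondr /=; apply: eq_bigr => s hs; case: eqP => e; last by rewrite big1.
  rewrite -card_after // ?sum1_card; last by move: hs => /andP[_ /andP[]].
  by rewrite -big_mkcondr sum1_card.
rewrite /expo [RHS](eq_bigl xpredT) => [|i]; last by rewrite ltn_ord.
rewrite exchange_big /=; apply: eq_bigr => i _.
(* Strings ending at N have no next vertex; their term is 0 because [dn] is 0 at N + 1. *)
rewrite big_ord_recr /= [X in _ = _ + X](_ : _ = 0) ?addn0; last first.
  by rewrite /remdim /Defs.dn ltnn muln0.
apply: eq_bigr => k _; congr (mE m i _ * _); apply/val_inj.
by rewrite /= inordK // ltnS ltnW.
Qed.

End Codimension.

(** * The ring of integer power series *)

Definition ps_opp (f : series) : series := fun n => - f n.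

(** Coefficients up to n of a product depend only on these truncations, so associativity and
    commutativity come from [{poly int}]. *)
Definition ps_trunc n (f : series) : {poly int} := \poly_(i < n.+1) f i.

Lemma coef_ps_trunc n f i : (i <= n)%N -> (ps_trunc n f)`_i = f i.
Proof. by move=> le; rewrite coef_poly ltnS le. Qed.

Lemma ps_mulE n f g i : (i <= n)%N -> ps_mul f g i = (ps_trunc n f * ps_trunc n g)`_i.
Proof.
move=> le; rewrite coefM; apply: eq_bigr => j _.
by rewrite !coef_ps_trunc ?(leq_trans (leq_subr _ _) le) // (leq_trans _ le) // -ltnS.
Qed.

Lemma ps_addA : associative ps_add.
Proof. by move=> f g h; apply: boolp.funext => n; apply: addrA. Qed.
Lemma ps_addC : commutative ps_add.
Proof. by move=> f g; apply: boolp.funext => n; apply: addrC. Qed.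
Lemma ps_add0 : left_id ps_zero ps_add.
Proof. by move=> f; apply: boolp.funext => n; apply: add0r. Qed.
Lemma ps_addN : left_inverse ps_zero ps_opp ps_add.
Proof. by move=> f; apply: boolp.funext => n; apply: addNr. Qed.

Lemma ps_mulA : associative ps_mul.
Proof.
move=> f g h; apply: boolp.funext => n.
have -> : ps_mul f (ps_mul g h) n = (ps_trunc n f * (ps_trunc n g * ps_trunc n h))`_n.
  rewrite coefM; apply: eq_bigr => j _.
  by rewrite coef_ps_trunc -1?ltnS // -ps_mulE ?leq_subr.
rewrite mulrA coefM; apply: eq_bigr => j _.
by rewrite coef_ps_trunc ?leq_subr // -ps_mulE // -ltnS.
Qed.

Lemma ps_mulC : commutative ps_mul.
Proof. by move=> f g; apply: boolp.funext => n; rewrite !(ps_mulE _ _ (leqnn n)) mulrC. Qed.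

Lemma ps_mul1 : left_id ps_one ps_mul.
Proof.
move=> f; apply: boolp.funext => n; rewrite /ps_mul big_ord_recl /= subn0 mul1r.
by rewrite big1 ?addr0 // => i _; rewrite /ps_one mul0r.
Qed.

Lemma ps_mulDl : left_distributive ps_mul ps_add.
Proof.
move=> f g h; apply: boolp.funext => n; rewrite /ps_mul /ps_add -big_split /=.
by apply: eq_bigr => i _; rewrite mulrDl.
Qed.

HB.instance Definition _ := boolp.gen_eqMixin series.
HB.instance Definition _ := boolp.gen_choiceMixin series.
HB.instance Definition _ := GRing.isZmodule.Build series ps_addA ps_addC ps_add0 ps_addN.

Lemma ps_one_neq0 : ps_one != (0 : series).
Proof. by apply/eqP => /(congr1 (fun f : series => f 0%N)). Qed.

HB.instance Definition _ :=
  GRing.Zmodule_isComNzRing.Build series ps_mulA ps_mulC ps_mul1 ps_mulDl ps_one_neq0.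

Lemma ps_mul_X k (f : series) n : (ps_X k * f) n = if (k <= n)%N then f (n - k)%N else 0.
Proof.
rewrite /GRing.mul /= /ps_mul; case: leqP => h.
  rewrite (bigD1 (Ordinal (h : (k < n.+1)%N))) //= /ps_X eqxx mul1r big1 ?addr0 // => i.
  by rewrite -val_eqE /= => /negbTE ->; rewrite mul0r.
rewrite big1 // => i _; rewrite /ps_X; case: eqP => [e|]; last by rewrite mul0r.
by have := ltn_ord i; rewrite e ltnS leqNgt h.
Qed.

Lemma ps_XE k : ps_X k = ps_X 1 ^+ k.
Proof.
elim: k => [|k IH]; first by [].
apply: boolp.funext => n; rewrite exprS -IH ps_mul_X; case: n => [|n] //=.
by rewrite subn1 /= /ps_X eqSS.
Qed.

Lemma ps_scale_sign s (f : series) : ps_scale ((-1) ^+ s) f = (-1) ^+ s * f.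
Proof.
apply: boolp.funext => n; rewrite /ps_scale -signr_odd -[in RHS]signr_odd.
by case: (odd s); rewrite ?expr0 ?mul1r // expr1 !mulN1r.
Qed.

Lemma nth_inv_rev f n i : (i <= n)%N -> nth 0 (inv_rev f n) i = ps_inv f (n - i)%N.
Proof.
elim: n i => [|n IH] [|i] //=.
by rewrite ltnS subSS => /IH <-.
Qed.

Lemma ps_mulV (f : series) : f 0%N = 1 -> f * ps_inv f = 1.
Proof.
move=> f0; apply: boolp.funext => -[|n]; rewrite /GRing.mul /= /ps_mul.
  by rewrite big_ord1 f0 mul1r.
rewrite big_ord_recl f0 mul1r subn0 {1}/ps_inv /=.
apply/eqP; rewrite addrC subr_eq0; apply/eqP; apply: eq_bigr => i _.
by rewrite nth_inv_rev ?subSS // -ltnS.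
Qed.

Lemma Pser0 : Pser 0 = 1.
Proof. by rewrite /Pser big_geq. Qed.

Lemma PserS n : Pser n = (1 - ps_X 1 ^+ n.+1) * Pser n.+1.
Proof.
have -> : Pser n.+1 = Pser n * ps_inv (1 - ps_X 1 ^+ n.+1).
  have e s : Pser s = \prod_(1 <= t < s.+1) ps_inv (1 - ps_X t) by [].
  by rewrite -ps_XE !e big_nat_recr.
by rewrite mulrCA ps_mulV ?mulr1 // -ps_XE.
Qed.

(** * Comparison of the two sides *)

Section Assembly.
Variables (N : nat) (d : 'I_N.+1 -> nat).

Lemma mind_le (k : 'I_N.+1) : (mind d <= d k)%N.
Proof.
have : k \in index_enum ('I_N.+1) by rewrite mem_index_enum.
rewrite /mind; elim: (index_enum _) => //= j s IH; rewrite big_cons in_cons.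
case/orP => [/eqP <-|/IH]; first exact: geq_minl.
exact/leq_trans/geq_minr.
Qed.

Lemma mind_attained : exists k, mind d = d k.
Proof.
apply: (big_ind (fun x => exists k, x = d k)); first by exists ord0.
  by move=> x y [k ->] [l ->]; case: (leqP (d k) (d l)) => h; [exists k|exists l].
by move=> k _; exists k.
Qed.

Lemma PmE (m : KP d) : kostant m -> Pm m = Pprefix Pser N.+1 m.
Proof.
move=> /andP[/forallP h _]; rewrite /Pprefix big_mkcond /=.
transitivity (\prod_(i < N.+1) \prod_(j < N.+1 | (i <= j)%N) Pser (mE m i j)); first by [].
apply: eq_bigr => i _; rewrite ltn_ord [LHS]big_mkcond /=.
apply: eq_bigr => j _; case: leqP => // lt.
by have /forallP/(_ j) := h i; rewrite lt => /eqP ->; rewrite Pser0.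
Qed.

End Assembly.

Theorem theorem5 (N : nat) (d : 'I_N.+1 -> nat) (r : nat) :
  (1 <= N)%N -> (r <= mind d)%N ->
  Qser d r =
  ps_mul (Pser r)
    (\big[ps_add/ps_zero]_(s < (mind d - r).+1)
       ps_scale ((-1) ^+ s)
         (ps_mul (ps_X 'C(s, 2))
            (ps_mul (Pser s) (Pvec (fun k : 'I_N.+1 => (d k - r - s)%N))))).
Proof.
move=> _ ler.
transitivity (\sum_(m : KP d | kostant m && (mE m ord0 ord_max == r)) kweight (ps_X 1) Pser m).
  transitivity (\sum_(m : KP d | kostant m && (mE m ord0 ord_max == r)) ps_X (codim (Defs.orbit
    m)) * Pm m); first by [].
  by apply: eq_bigr => m /andP[km _]; rewrite codim_orbit // ps_XE PmE.
rewrite (kostant_sum d Pser0 PserS) (row_sum_end Pser0 PserS _ _ (ltnSn _)).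
transitivity (Pser r * \sum_(s < (mind d - r).+1) (-1) ^+ s *
   (ps_X 'C(s, 2) * (Pser s * Pvec (fun k : 'I_N.+1 => (d k - r - s)%N)))); last first.
  by congr (ps_mul _ _); apply: eq_bigr => s _; rewrite ps_scale_sign.
congr (_ * _).
have prodE s : \prod_(e <- dn d 0 :: [seq dn d k | k <- iota 1 N]) Psub Pser e (r + s) =
               \prod_(k < N.+1) Psub Pser (d k) (r + s).
  transitivity (\prod_(0 <= k < N.+1) Psub Pser (dn d k) (r + s)).
    by rewrite -[_ :: _]/(map (dn d) (iota 0 N.+1)) big_map.
  rewrite big_mkord.
  by apply: eq_bigr => k _; rewrite dn_ord.
under eq_bigr => s _ do rewrite prodE.
(* [row_sum_end] gives a sum up to d_0. The terms with r + s above the minimum of d vanish, through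
   the [Psub] factor of a vertex attaining it. *)
have le0 : (mind d - r < (dn d 0).+1)%N.
  by rewrite ltnS (leq_trans (leq_subr _ _)) // -[0%N]/(val (@ord0 N)) dn_ord mind_le.
rewrite [RHS](big_ord_widen _ (fun s => (-1) ^+ s * (ps_X 'C(s, 2) * (Pser s * Pvec (fun k :
  'I_N.+1 => (d k - r - s)%N)))) le0).
rewrite [RHS]big_mkcond; apply: eq_bigr => s _; rewrite ltnS; case: leqP => h.
  rewrite -!mulrA [ps_X 'C(_, _)]ps_XE; congr (_ * (_ * (_ * _))).
  transitivity (\prod_(k < N.+1) Pser (d k - r - s)); last by [].
  apply: eq_bigr => k _; rewrite /Psub subnDA ifT //.
  by have := mind_le d k; lia.
have [k e] := mind_attained d.
rewrite (bigD1 k) //= /Psub ifF ?mul0r ?mulr0 //; lia.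
Qed.
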